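(* For every rational number $v\ge1$ (resp. every Perron number $v>1$) and every integer $b\ge2$ there exists a real number $\xi$ whose base-$b$ expansion is an automatic (resp. morphic) infinite word over $\{0,1,\ldots,b-1\}$ and such that $v_b(\xi)=v-1$.
   Context: A Perron number is a positive real algebraic integer that is strictly greater in absolute value than all of its other Galois conjugates. For a real $x$, $\|x\|$ denotes the distance from $x$ to the nearest integer. For a real $\xi$ and integer $b\ge 2$, $v_b(\xi)$ is the supremum of the real numbers $v$ such that $\|b^n\xi\|<(b^n)^{-v}$ has infinitely many solutions in positive integers $n$. The base-$b$ expansion of $\xi$ is the digit sequence $d_1d_2\cdots$ with $d_n\in\{0,\dots,b-1\}$, not ending in $(b-1)^\omega$, with $\xi=\lfloor\xi\rfloor+\sum_{n\ge1}d_nb^{-n}$. Morphic/automatic words: Let $\Sigma$ be a finite alphabet and $\epsilon$ the empty word. A morphism $h:\Sigma^*\to\Sigma^*$ is prolongable on $a\in\Sigma$ if $h(a)=ax$ with $x\in\Sigma^+$ and $h^n(x)\ne\epsilon$ for all $n\ge0$; then $h^n(a)$ converges to the infinite word $h^\omega(a)=a\,x\,h(x)\,h^2(x)\cdots$, called a pure morphic word. A coding is a letter-to-letter morphism. An infinite word is morphic if it is the image under a coding of a pure morphic word, and automatic if it is the image under a coding of a pure morphic word $h^\omega(a)$ with $h$ uniform (all $|h(c)|$ equal). *)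

(* Defs.v *)
From Stdlib Require Import Reals ZArith List Lra.
Import ListNotations.
Open Scope R_scope.

(* Int_part x is the floor of x (Int_part x = up x - 1). *)
Definition dist_nearest_int (x : R) : R :=
  let f := x - IZR (Int_part x) in Rmin f (1 - f).

Definition vb_set (b : nat) (xi : R) (v : R) : Prop :=
  forall N : nat, exists n : nat, (N <= n)%nat /\ (1 <= n)%nat /\
    dist_nearest_int (INR b ^ n * xi) < Rpower (INR b ^ n) (- v).

Definition vb_eq (b : nat) (xi : R) (w : R) : Prop := is_lub (vb_set b xi) w.

(* d n is the digit d_{n+1} of the paper. *)
Definition is_base_expansion (b : nat) (xi : R) (d : nat -> nat) : Prop :=
  (forall n, (d n < b)%nat) /\
  ~ (exists N, forall n, (N <= n)%nat -> d n = (b - 1)%nat) /\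
  infinite_sum (fun n => INR (d n) / INR b ^ (S n)) (xi - IZR (Int_part xi)).

(* Alphabet Sigma = {0,...,k-1} encoded in nat; morphisms are maps letter -> word. *)

Definition morph_apply (h : nat -> list nat) (u : list nat) : list nat :=
  flat_map h u.

Definition morph_iter (h : nat -> list nat) (n : nat) (u : list nat) : list nat :=
  Nat.iter n (morph_apply h) u.

Definition is_morphism (k : nat) (h : nat -> list nat) : Prop :=
  forall c, (c < k)%nat -> forall c', In c' (h c) -> (c' < k)%nat.

Definition prolongable (k : nat) (h : nat -> list nat) (a : nat) : Prop :=
  (a < k)%nat /\ exists x, h a = a :: x /\ x <> [] /\
    forall n, morph_iter h n x <> [].

Definition is_fixed_word (h : nat -> list nat) (a : nat) (w : nat -> nat) : Prop :=
  forall n i, (i < length (morph_iter h n [a]))%nat ->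
    w i = nth i (morph_iter h n [a]) 0%nat.

Definition is_uniform (k : nat) (h : nat -> list nat) : Prop :=
  exists q, forall c, (c < k)%nat -> length (h c) = q.

Definition is_morphic (b : nat) (d : nat -> nat) : Prop :=
  exists (k : nat) (h : nat -> list nat) (a : nat) (tau : nat -> nat) (w : nat -> nat),
    is_morphism k h /\ prolongable k h a /\ is_fixed_word h a w /\
    (forall c, (c < k)%nat -> (tau c < b)%nat) /\
    forall n, d n = tau (w n).

Definition is_automatic (b : nat) (d : nat -> nat) : Prop :=
  exists (k : nat) (h : nat -> list nat) (a : nat) (tau : nat -> nat) (w : nat -> nat),
    is_morphism k h /\ is_uniform k h /\ prolongable k h a /\ is_fixed_word h a w /\
    (forall c, (c < k)%nat -> (tau c < b)%nat) /\
    forall n, d n = tau (w n).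

Definition is_rational (v : R) : Prop :=
  exists p q : Z, (0 < q)%Z /\ v = IZR p / IZR q.

(* integer polynomials as lists of coefficients, lowest degree first *)
Definition zpoly_monic (P : list Z) : Prop := exists l, P = l ++ [1%Z].

Definition zpoly_eval (P : list Z) (x : R) : R :=
  fold_right (fun c acc => IZR c + x * acc) 0 P.

Definition cmul (z w : R * R) : R * R :=
  (fst z * fst w - snd z * snd w, fst z * snd w + snd z * fst w).
Definition cadd (z w : R * R) : R * R := (fst z + fst w, snd z + snd w).
Definition cmod (z : R * R) : R := sqrt (fst z ^ 2 + snd z ^ 2).

Definition zpoly_ceval (P : list Z) (z : R * R) : R * R :=
  fold_right (fun c acc => cadd (IZR c, 0) (cmul z acc)) (0, 0) P.

(* P is the minimal polynomial of the algebraic integer x: a monic integer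
   polynomial of least degree vanishing at x (this is the minimal polynomial
   over Q, by Gauss's lemma). *)
Definition is_min_poly (P : list Z) (x : R) : Prop :=
  zpoly_monic P /\ zpoly_eval P x = 0 /\
  forall Q, zpoly_monic Q -> zpoly_eval Q x = 0 -> (length P <= length Q)%nat.

Definition is_alg_integer (x : R) : Prop :=
  exists P, zpoly_monic P /\ zpoly_eval P x = 0.

Definition is_perron (x : R) : Prop :=
  0 < x /\ is_alg_integer x /\
  forall P, is_min_poly P x ->
    forall z : R * R, zpoly_ceval P z = (0, 0) -> z <> (x, 0) -> cmod z < Rabs x.

(* Main.v *)
Require Import Defs.
From Stdlib Require Import Reals ZArith List Lra Lia Bool Classical.
From Coquelicot Require Import Coquelicot.
From mathcomp Require all_boot all_order all_algebra ring lra ssrZ Rstruct complex.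
Import ListNotations.
Open Scope R_scope.

(** With digits 0 and 1 and no two consecutive 1s, [v_b (xi)] is governed by the
    longest runs of zeros: if they have length about [(v - 1) n] relative to their
    starting point [n], then [v_b (xi) = v - 1].

    For [v = p / q], take a power of two [c > p] and put zeros exactly on the
    intervals [q c^k <= n < p c^k], which are read off the leading base-[c] digit,
    and alternating digits elsewhere.

    For a Perron number [v], the morphic word is a concatenation of blocks 1 0^(N_k)
    with [N_(k+1) / N_k -> v], so a nonnegative integer linear system generating such
    a sequence is needed. Let [lambda] run over the conjugates of [v] and let
    [A i k] be the integer sum of [lambda^k (lambda^m - t)^i], which is equivalent
    to [v^k (v^m - t)^i]. If [p_m] has the roots [lambda^m], with [m] large and [t]
    an integer between large multiples of the other [|lambda|^m] and small multiples
    of [v^m], then [p_m (X + t)] is close to [(X - v^m) (X + t)^(d-1)] and all its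
    nonleading coefficients are nonpositive, which gives nonnegative recurrences
    [A i (k + m) = t A i k + A (i + 1) k] and
    [A (d-1) (k + m) = t A (d-1) k + sum of the c_i A i k]. The initial values of the
    [A i] become word lengths by means of erased filler letters. *)

(** * Digit expansions with long runs of zeros *)

(** The number 0.d_n d_(n+1) ... in base b, that is, b^n times [tail b d 0] modulo the integers. *)
Definition tail (b : nat) (d : nat -> nat) (n : nat) : R :=
  Series (fun j => INR (d (n + j)%nat) / INR b ^ S j).

Section Tail.
Variables (b : nat) (d : nat -> nat).
Hypothesis (Hb : (2 <= b)%nat) (Hd : forall n, (d n < b)%nat).

Let b_ge2 : 2 <= INR b.
Proof. apply le_INR in Hb. simpl in Hb. lra. Qed.

Let pow_b_pos n : 0 < INR b ^ n.
Proof. apply pow_lt. lra. Qed.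

Lemma digit_term_bound n j :
  0 <= INR (d (n + j)%nat) / INR b ^ S j <= (INR b - 1) / INR b * (/ INR b) ^ j.
Proof.
  assert (H : INR (d (n + j)%nat) <= INR b - 1).
  { pose proof (Hd (n + j)%nat) as H. apply le_INR in H. rewrite S_INR in H. lra. }
  split.
  - apply Rdiv_le_0_compat; [apply pos_INR|apply pow_b_pos].
  - rewrite pow_inv. replace ((INR b - 1) / INR b * / INR b ^ j) with ((INR b - 1) / INR b ^ S j).
    + apply Rmult_le_compat_r; [|exact H]. left. apply Rinv_0_lt_compat, pow_b_pos.
    + simpl. field. split; [apply Rgt_not_eq, pow_b_pos|lra].
Qed.

Lemma is_series_max_digits :
  is_series (fun j => (INR b - 1) / INR b * (/ INR b) ^ j) 1.
Proof.
  assert (E : (INR b - 1) / INR b * / (1 - / INR b) = 1) by (field; lra).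
  refine (eq_ind _ (fun x => is_series _ x) _ _ E).
  apply (is_series_scal_l (V := R_NormedModule)), is_series_geom.
  rewrite Rabs_right; [|apply Rle_ge; left; apply Rinv_0_lt_compat; lra].
  rewrite <- Rinv_1. apply Rinv_lt_contravar; lra.
Qed.

Lemma ex_series_tail n : ex_series (fun j => INR (d (n + j)%nat) / INR b ^ S j).
Proof.
  apply (ex_series_le (V := R_CompleteNormedModule)) with
    (fun j => (INR b - 1) / INR b * (/ INR b) ^ j); [|eexists; apply is_series_max_digits].
  intro j. destruct (digit_term_bound n j).
  change (norm ?x) with (Rabs x). rewrite Rabs_right; lra.
Qed.

Lemma tail_bounds n : 0 <= tail b d n <= 1.
Proof.
  split.
  - rewrite <- (Rmult_0_l (tail b d n)). unfold tail. rewrite <- Series_scal_l.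
    apply Series_le; [|apply ex_series_tail].
    intro j. destruct (digit_term_bound n j). lra.
  - rewrite <- (is_series_unique _ _ is_series_max_digits).
    apply Series_le; [apply digit_term_bound|eexists; apply is_series_max_digits].
Qed.

Lemma tail_step n : tail b d n = (INR (d n) + tail b d (S n)) / INR b.
Proof.
  unfold tail. rewrite Series_incr_1 by apply ex_series_tail.
  rewrite Nat.add_0_r.
  rewrite (Series_ext _ (fun j => / INR b * (INR (d (S n + j)%nat) / INR b ^ S j))).
  - rewrite Series_scal_l. simpl. field. lra.
  - intro j. rewrite Nat.add_succ_r. simpl. field.
    split; [apply Rgt_not_eq, pow_b_pos|lra].
Qed.

Lemma tail_le_of_zeros l n :
  (forall j, (j < l)%nat -> d (n + j)%nat = 0%nat) -> tail b d n <= / INR b ^ l.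
Proof.
  revert n. induction l as [|l IH]; intros n H.
  - simpl. rewrite Rinv_1. apply tail_bounds.
  - rewrite tail_step. specialize (H 0%nat) as H0. rewrite Nat.add_0_r in H0.
    rewrite H0 by lia. simpl. unfold Rdiv. rewrite Rinv_mult, Rplus_0_l, Rmult_comm.
    apply Rmult_le_compat_l; [left; apply Rinv_0_lt_compat; lra|].
    apply IH. intros j Hj. rewrite <- (H (S j)) by lia. f_equal. lia.
Qed.

Lemma tail_ge_of_digit l n : (1 <= d (n + l)%nat)%nat -> / INR b ^ S l <= tail b d n.
Proof.
  revert n. induction l as [|l IH]; intros n H; rewrite tail_step; simpl;
    rewrite Rinv_mult, Rmult_comm;
    (apply Rmult_le_compat_r; [left; apply Rinv_0_lt_compat; lra|]).
  - rewrite Nat.add_0_r in H. apply le_INR in H. simpl in H.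
    rewrite Rinv_1. destruct (tail_bounds (S n)). lra.
  - rewrite Nat.add_succ_r in H. specialize (IH (S n) H). simpl in IH.
    pose proof (pos_INR (d n)). lra.
Qed.

(** Mirror image of [tail_ge_of_digit]: 1 - [tail] obeys the recursion of [tail_step] for the
    complementary digits b - 1 - d. *)
Lemma tail_le_of_digit l n :
  (S (d (n + l)%nat) < b)%nat -> / INR b ^ S l <= 1 - tail b d n.
Proof.
  assert (E : forall n, 1 - tail b d n
     = (INR b - 1 - INR (d n) + (1 - tail b d (S n))) / INR b).
  { intro k. rewrite (tail_step k). field. lra. }
  assert (D : forall n, INR (d n) <= INR b - 1).
  { intro k. specialize (Hd k). apply le_INR in Hd. rewrite S_INR in Hd. lra. }
  revert n. induction l as [|l IH]; intros n H; rewrite E; simpl;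
    rewrite Rinv_mult, Rmult_comm;
    (apply Rmult_le_compat_r; [left; apply Rinv_0_lt_compat; lra|]).
  - rewrite Nat.add_0_r in H. apply le_INR in H. rewrite !S_INR in H.
    rewrite Rinv_1. destruct (tail_bounds (S n)). lra.
  - rewrite Nat.add_succ_r in H. specialize (IH (S n) H). simpl in IH.
    pose proof (D n). lra.
Qed.

Lemma pow_mul_tail n : exists z, INR b ^ n * tail b d 0 = IZR z + tail b d n.
Proof.
  induction n as [|n [z IH]]; [exists 0%Z; simpl; lra|].
  exists (Z.of_nat b * z + Z.of_nat (d n))%Z.
  simpl. rewrite Rmult_assoc, IH, (tail_step n), plus_IZR, mult_IZR, <- !INR_IZR_INZ.
  field. lra.
Qed.

Lemma dist_pow_mul_tail n : tail b d n < 1 ->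
  dist_nearest_int (INR b ^ n * tail b d 0) = Rmin (tail b d n) (1 - tail b d n).
Proof.
  intro H1. destruct (pow_mul_tail n) as [z E]. destruct (tail_bounds n) as [H0 _].
  unfold dist_nearest_int. rewrite E.
  rewrite <- (Int_part_spec (IZR z + tail b d n) z) by lra.
  replace (IZR z + tail b d n - IZR z) with (tail b d n) by ring. reflexivity.
Qed.

End Tail.

Lemma Rpower_pow_base b n x : (2 <= b)%nat -> Rpower (INR b ^ n) x = Rpower (INR b) (INR n * x).
Proof.
  intro Hb. apply le_INR in Hb. simpl in Hb.
  rewrite <- Rpower_pow by lra. apply Rpower_mult.
Qed.

Lemma inv_pow_Rpower b n : (2 <= b)%nat -> / INR b ^ n = Rpower (INR b) (- INR n).
Proof.
  intro Hb. apply le_INR in Hb. simpl in Hb.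
  rewrite Rpower_Ropp, Rpower_pow by lra. reflexivity.
Qed.

(** The next digit 1 after position n bounds the distance of b^n xi to the integer below it from
    below, and a run of zeros bounds it from above. Forbidding two consecutive 1s keeps every tail
    away from 1, even for b = 2, so the integer above never comes close. *)
Lemma vb_of_zero_runs (b : nat) (d : nat -> nat) (w : R) :
  (2 <= b)%nat -> 0 <= w ->
  (forall n, (d n <= 1)%nat) ->
  (forall n, d n = 0%nat \/ d (S n) = 0%nat) ->
  (forall eps, 0 < eps -> exists N, forall n, (N <= n)%nat ->
     exists l, d (n + l)%nat = 1%nat /\ INR l <= (w + eps) * INR n) ->
  (forall eps, 0 < eps -> forall N, exists n l, (N <= n)%nat /\ (1 <= n)%nat /\
     (forall j, (j < l)%nat -> d (n + j)%nat = 0%nat) /\ (w - eps) * INR n <= INR l) ->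
  is_base_expansion b (tail b d 0) d /\ vb_eq b (tail b d 0) w.
Proof.
  intros Hb Hw Hd1 Hzero Hone Hrun.
  assert (Hd : forall n, (d n < b)%nat) by (intro n; specialize (Hd1 n); lia).
  assert (Hb2 : 2 <= INR b) by (apply le_INR in Hb; simpl in Hb; lra).
  assert (Hup : forall n, / INR b ^ 2 <= 1 - tail b d n).
  { intro n. destruct (Hzero n) as [H|H].
    - apply Rle_trans with (/ INR b ^ 1).
      + apply Rinv_le_contravar; [apply pow_lt; lra|]. apply Rle_pow; [lra|lia].
      + apply tail_le_of_digit; auto. rewrite Nat.add_0_r, H. lia.
    - apply tail_le_of_digit; auto. rewrite Nat.add_1_r, H. lia. }
  assert (Hpos2 : 0 < / INR b ^ 2) by (apply Rinv_0_lt_compat, pow_lt; lra).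
  assert (Hlt1 : forall n, tail b d n < 1) by (intro n; specialize (Hup n); lra).
  split; [split; [exact Hd|split]|].
  - intros [N HN]. destruct (Hzero N) as [H|H]; rewrite HN in H; lia.
  - destruct (tail_bounds b d Hb Hd 0) as [H0 _].
    rewrite <- (Int_part_spec (tail b d 0) 0) by (specialize (Hlt1 0%nat); lra).
    rewrite Rminus_0_r. apply is_series_Reals, Series_correct, (ex_series_tail b d Hb Hd 0).
  - split.
    + intros u Hu. apply Rnot_lt_le. intro Hwu.
      destruct (Hone ((u - w) / 2)) as [N HN]; [lra|].
      (* For n >= M the slack (u - w) / 2 * n exceeds 2, which pays for the exponent l + 2 below.
         That exponent covers both b^-(l+1), the bound for the tail, and b^-2, the bound for its
         complement. *)
      destruct (archimed_cor1 ((u - w) / 4)) as [M [HM HM0]]; [lra|].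
      destruct (Hu (N + M)%nat) as [n [HNn [Hn1 Hn]]].
      destruct (HN n) as [l [Hl Hln]]; [lia|].
      rewrite dist_pow_mul_tail in Hn by auto.
      apply (Rlt_irrefl (Rpower (INR b ^ n) (- u))).
      apply Rle_lt_trans with (2 := Hn).
      apply Rle_trans with (/ INR b ^ (l + 2)).
      * rewrite inv_pow_Rpower, Rpower_pow_base by assumption.
        apply Rle_Rpower; [lra|]. rewrite plus_INR. simpl (INR 2).
        assert (HnM : INR M <= INR n) by (apply le_INR; lia).
        assert (HM1 : 0 < INR M) by (apply lt_0_INR; lia).
        assert (1 < (u - w) / 4 * INR M).
        { apply Rmult_lt_compat_r with (r := INR M) in HM; [|assumption].
          rewrite Rinv_l in HM by lra. exact HM. }
        nra.
      * apply Rmin_glb.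
        -- apply Rle_trans with (/ INR b ^ S l).
           ++ apply Rinv_le_contravar; [apply pow_lt; lra|]. apply Rle_pow; [lra|lia].
           ++ apply tail_ge_of_digit; auto. rewrite Hl. lia.
        -- apply Rle_trans with (/ INR b ^ 2); auto.
           apply Rinv_le_contravar; [apply pow_lt; lra|]. apply Rle_pow; [lra|lia].
    + intros m Hm. apply Rnot_lt_le. intro Hmw.
      (* The midpoint of m and w lies below w - (w - m) / 4, the ratio that the runs attain, and
         above the supposed upper bound m. *)
      assert (Hin : vb_set b (tail b d 0) ((m + w) / 2)); [|specialize (Hm _ Hin); lra].
      intro N. destruct (Hrun ((w - m) / 4) ltac:(lra) N) as [n [l [HNn [Hn1 [Hz Hl]]]]].
      exists n. split; [exact HNn|split; [exact Hn1|]].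
      rewrite dist_pow_mul_tail by auto.
      apply Rle_lt_trans with (tail b d n); [apply Rmin_l|].
      apply Rle_lt_trans with (1 := tail_le_of_zeros b d Hb Hd l n Hz).
      rewrite inv_pow_Rpower, Rpower_pow_base by assumption.
      apply Rpower_lt; [lra|].
      assert (1 <= INR n) by (apply (le_INR 1); exact Hn1). nra.
Qed.

(** * Rational exponents *)

Lemma map_add_seq a n s : map (fun r => (a + r)%nat) (seq s n) = seq (a + s) n.
Proof.
  revert s. induction n as [|n IH]; intro s; [reflexivity|].
  simpl. rewrite IH. do 2 f_equal. lia.
Qed.

Lemma morph_iter_app h n u v :
  morph_iter h n (u ++ v) = morph_iter h n u ++ morph_iter h n v.
Proof.
  induction n as [|n IH]; [reflexivity|].
  change (morph_iter ?h (S n) ?u) with (morph_apply h (morph_iter h n u)).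
  rewrite IH. apply flat_map_app.
Qed.

Lemma morph_iter_succ_r h n u : morph_iter h (S n) u = morph_iter h n (morph_apply h u).
Proof. apply Nat.iter_succ_r. Qed.

(** * The leading base-2^e digit as an automatic sequence *)

(** The leading digit of n in base 2^e: [Nat.log2 n / e] is the number of digits minus one. It is 0
    for n = 0. *)
Definition lead (e n : nat) : nat := n / 2 ^ (e * (Nat.log2 n / e)).

Definition lead_parity (e n : nat) : nat := 2 * lead e n + n mod 2.

(** Sends the letter of n to the letters of 2^e n + r for r < 2^e. The leading digit is inherited,
    except from n = 0, where it is r itself; the parity is that of r because 2^e is even. *)
Definition lead_parity_morphism (e x : nat) : list nat :=
  map (fun r => 2 * (if x / 2 =? 0 then r else x / 2) + r mod 2)%nat (seq 0 (2 ^ e)).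

Lemma lead_eq e k n : (0 < e)%nat -> (2 ^ (e * k) <= n < 2 ^ (e * S k))%nat ->
  lead e n = (n / 2 ^ (e * k))%nat.
Proof.
  intros He [H1 H2]. unfold lead. do 3 f_equal.
  pose proof (Nat.pow_nonzero 2 (e * k)).
  assert (Hn : (0 < n)%nat) by lia.
  apply Nat.log2_le_pow2 in H1; [|lia].
  apply Nat.log2_lt_pow2 in H2; [|lia].
  symmetry. apply (Nat.div_unique _ _ _ (Nat.log2 n - e * k)); nia.
Qed.

Lemma lead_exists e n : (0 < e)%nat -> (0 < n)%nat ->
  exists k, (2 ^ (e * k) <= n < 2 ^ (e * S k))%nat.
Proof.
  intros He Hn. exists (Nat.log2 n / e)%nat.
  pose proof (Nat.div_mod_eq (Nat.log2 n) e).
  pose proof (Nat.mod_upper_bound (Nat.log2 n) e).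
  pose proof (Nat.log2_spec n Hn) as [H1 H2]. split.
  - apply Nat.le_trans with (2 := H1). apply Nat.pow_le_mono_r; lia.
  - apply Nat.lt_le_trans with (1 := H2). apply Nat.pow_le_mono_r; nia.
Qed.

Lemma lead_small e r : (0 < e)%nat -> (r < 2 ^ e)%nat -> lead e r = r.
Proof.
  intros He Hr. destruct r as [|r].
  - unfold lead. apply Nat.Div0.div_0_l.
  - rewrite (lead_eq e 0), Nat.mul_0_r by (rewrite ?Nat.mul_0_r, ?Nat.mul_1_r; simpl; lia).
    apply Nat.div_1_r.
Qed.

Lemma lead_pos e n : (0 < e)%nat -> (0 < n)%nat -> (0 < lead e n < 2 ^ e)%nat.
Proof.
  intros He Hn. destruct (lead_exists e n He Hn) as [k Hk].
  rewrite (lead_eq e k n He Hk). pose proof (Nat.pow_nonzero 2 (e * k)).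
  split.
  - apply Nat.div_str_pos. lia.
  - apply Nat.Div0.div_lt_upper_bound. rewrite <- Nat.pow_add_r.
    replace (e * k + e)%nat with (e * S k)%nat by lia. lia.
Qed.

Lemma lead_append e n r : (0 < e)%nat -> (0 < n)%nat -> (r < 2 ^ e)%nat ->
  lead e (2 ^ e * n + r) = lead e n.
Proof.
  intros He Hn Hr. destruct (lead_exists e n He Hn) as [k Hk].
  rewrite (lead_eq e k n He Hk), (lead_eq e (S k)); [|assumption|].
  - rewrite Nat.mul_succ_r, Nat.add_comm, (Nat.add_comm _ e), Nat.pow_add_r.
    rewrite <- Nat.Div0.div_div. f_equal.
    symmetry. apply (Nat.div_unique _ _ _ r); lia.
  - rewrite (Nat.mul_succ_r e (S k)), (Nat.add_comm _ e), Nat.pow_add_r.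
    rewrite Nat.mul_succ_r, (Nat.add_comm _ e), Nat.pow_add_r in *. nia.
Qed.

Lemma pow2_even e n r : (0 < e)%nat -> ((2 ^ e * n + r) mod 2 = r mod 2)%nat.
Proof.
  intro He. destruct e as [|e]; [lia|].
  rewrite Nat.pow_succ_r', Nat.add_comm, (Nat.mul_comm 2), <- Nat.mul_assoc, (Nat.mul_comm 2 n).
  rewrite Nat.mul_assoc. apply Nat.Div0.mod_add.
Qed.

Lemma lead_parity_div2 e n : (lead_parity e n / 2 = lead e n)%nat.
Proof.
  unfold lead_parity. pose proof (Nat.mod_upper_bound n 2).
  symmetry. apply (Nat.div_unique _ _ _ (n mod 2)); lia.
Qed.

Lemma lead_parity_mod2 e n : (lead_parity e n mod 2 = n mod 2)%nat.
Proof.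
  unfold lead_parity. pose proof (Nat.mod_upper_bound n 2).
  symmetry. apply (Nat.mod_unique _ _ (lead e n)); lia.
Qed.

Lemma lead_parity_morphismE e n : (0 < e)%nat ->
  lead_parity_morphism e (lead_parity e n) = map (lead_parity e) (seq (2 ^ e * n) (2 ^ e)).
Proof.
  intro He. rewrite <- (Nat.add_0_r (2 ^ e * n)), <- map_add_seq, map_map.
  apply map_ext_in. intros r Hr. apply in_seq in Hr.
  rewrite lead_parity_div2. unfold lead_parity. rewrite pow2_even by assumption.
  (* A digit appended to 0 becomes the leading digit; appended to n > 0 it leaves the leading digit
     alone. *)
  do 2 f_equal. destruct n as [|n].
  - rewrite Nat.mul_0_r, lead_small by lia. rewrite lead_small by lia. reflexivity.
  - rewrite lead_append by lia. pose proof (lead_pos e (S n)).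
    destruct (Nat.eqb_spec (lead e (S n)) 0); lia.
Qed.

Lemma lead_parity_morphism_iter e k : (0 < e)%nat ->
  morph_iter (lead_parity_morphism e) k [0%nat] = map (lead_parity e) (seq 0 ((2 ^ e) ^ k)).
Proof.
  intro He. induction k as [|k IH].
  - simpl. unfold lead_parity. rewrite lead_small by (try apply Nat.neq_0_lt_0, Nat.pow_nonzero; lia).
    reflexivity.
  - change (morph_iter ?h (S k) ?u) with (morph_apply h (morph_iter h k u)). rewrite IH.
    simpl. generalize ((2 ^ e) ^ k)%nat. intro M. unfold morph_apply.
    induction M as [|M IHM]; [rewrite Nat.mul_0_r; reflexivity|].
    rewrite seq_S, map_app, flat_map_app, IHM. simpl. rewrite app_nil_r.
    rewrite lead_parity_morphismE, <- map_app, Nat.mul_succ_r, seq_app by assumption. reflexivity.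
Qed.

Lemma lead_parity_automatic b e tau : (0 < e)%nat -> (forall c, (tau c < b)%nat) ->
  is_automatic b (fun n => tau (lead_parity e n)).
Proof.
  intros He Htau. pose proof (Nat.pow_gt_1 2 e ltac:(lia) ltac:(lia)) as Hc.
  exists (2 * 2 ^ e)%nat, (lead_parity_morphism e), 0%nat, tau, (lead_parity e).
  assert (Hh : forall x, lead_parity_morphism e x <> []).
  { intros x H. apply (f_equal (@length nat)) in H.
    unfold lead_parity_morphism in H. rewrite length_map, length_seq in H. simpl in H. lia. }
  split; [|split; [|split; [|split; [|split]]]].
  - intros x Hx y Hy. apply in_map_iff in Hy. destruct Hy as [r [<- Hr]].
    apply in_seq in Hr. pose proof (Nat.mod_upper_bound r 2).
    assert (x / 2 < 2 ^ e)%nat by (apply Nat.Div0.div_lt_upper_bound; lia).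
    destruct (x / 2 =? 0); lia.
  - exists (2 ^ e)%nat. intros x _. unfold lead_parity_morphism.
    rewrite length_map. apply length_seq.
  - split; [lia|].
    exists (tl (lead_parity_morphism e 0)). split; [|split].
    + unfold lead_parity_morphism. destruct (2 ^ e)%nat; [lia|reflexivity].
    + unfold lead_parity_morphism. destruct (2 ^ e)%nat as [|[|c]]; [lia|lia|discriminate].
    + intro n. assert (Hx : tl (lead_parity_morphism e 0) <> []).
      { unfold lead_parity_morphism. destruct (2 ^ e)%nat as [|[|c]]; [lia|lia|discriminate]. }
      revert Hx. generalize (tl (lead_parity_morphism e 0)). intros u Hu.
      induction n as [|n IH]; [exact Hu|].
      simpl. fold (morph_iter (lead_parity_morphism e) n u).
      destruct (morph_iter (lead_parity_morphism e) n u) as [|y l]; [contradiction|].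
      simpl. intro E. apply app_eq_nil in E. apply (Hh y), E.
  - intros n i Hi. rewrite lead_parity_morphism_iter in * by assumption.
    rewrite length_map, length_seq in Hi.
    rewrite (nth_indep _ _ (lead_parity e 0)) by (rewrite length_map, length_seq; exact Hi).
    rewrite map_nth, seq_nth by assumption. reflexivity.
  - intros; apply Htau.
  - reflexivity.
Qed.

Lemma rational_case (v : R) (b : nat) : is_rational v -> 1 <= v -> (2 <= b)%nat ->
  exists (xi : R) (d : nat -> nat),
    is_base_expansion b xi d /\ is_automatic b d /\ vb_eq b xi (v - 1).
Proof.
  intros [p' [q' [Hq' Ev]]] Hv Hb.
  assert (Hq0 : 0 < IZR q') by (apply IZR_lt; assumption).
  assert (Hpq' : (q' <= p')%Z).
  { apply le_IZR. apply Rmult_le_reg_r with (/ IZR q'); [apply Rinv_0_lt_compat; lra|].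
    rewrite Rinv_r by lra. unfold Rdiv in Ev. lra. }
  destruct (Z_of_nat_complete p') as [p ->]; [lia|].
  destruct (Z_of_nat_complete q') as [q ->]; [lia|].
  rewrite <- !INR_IZR_INZ in *.
  assert (Hq : (0 < q)%nat) by lia. assert (Hpq : (q <= p)%nat) by lia.
  clear Hq' Hpq'.
  (* This makes 2^e > p, so that leading digits from q up to p are all available in base 2^e. *)
  pose (e := S p).
  assert (He : (0 < e)%nat) by (unfold e; lia).
  assert (Hpe : (p < 2 ^ e)%nat).
  { pose proof (Nat.pow_gt_lin_r 2 e). unfold e in *. lia. }
  pose (tau x := if (q <=? x / 2) && (x / 2 <? p) then 0%nat else (x mod 2)%nat).
  assert (Htau : forall x, (tau x <= 1)%nat).
  { intro x. unfold tau. pose proof (Nat.mod_upper_bound x 2).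
    destruct ((q <=? x / 2) && (x / 2 <? p)); lia. }
  pose (d n := tau (lead_parity e n)).
  assert (dE : forall n, d n = if (q <=? lead e n) && (lead e n <? p) then 0%nat else (n mod 2)%nat).
  { intro n. unfold d, tau. rewrite lead_parity_div2, lead_parity_mod2. reflexivity. }
  assert (Hd0 : forall k n, (q * 2 ^ (e * k) <= n < p * 2 ^ (e * k))%nat -> d n = 0%nat).
  { intros k n Hn. pose proof (Nat.pow_nonzero 2 (e * k) ltac:(lia)) as Hz.
    rewrite dE, (lead_eq e k) by (rewrite ?Nat.mul_succ_r, ?Nat.pow_add_r; nia).
    assert (q <= n / 2 ^ (e * k))%nat by (apply Nat.div_le_lower_bound; lia).
    assert (n / 2 ^ (e * k) < p)%nat by (apply Nat.Div0.div_lt_upper_bound; lia).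
    destruct (Nat.leb_spec q (n / 2 ^ (e * k))), (Nat.ltb_spec (n / 2 ^ (e * k)) p); simpl; lia. }
  assert (Hdodd : forall n, ~ (q <= lead e n < p)%nat -> d n = (n mod 2)%nat).
  { intros n Hn. rewrite dE.
    destruct (Nat.leb_spec q (lead e n)), (Nat.ltb_spec (lead e n) p); simpl; lia. }
  assert (Hv1 : v * INR q = INR p) by (rewrite Ev; field; lra).
  destruct (vb_of_zero_runs b d (v - 1) Hb ltac:(lra)) as [E1 E2].
  - intro n. apply Htau.
  - intro n. rewrite !dE. pose proof (Nat.div_mod_eq n 2). pose proof (Nat.mod_upper_bound n 2).
    pose proof (Nat.div_mod_eq (S n) 2). pose proof (Nat.mod_upper_bound (S n) 2).
    destruct ((q <=? lead e n) && (lead e n <? p)); [lia|].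
    destruct ((q <=? lead e (S n)) && (lead e (S n) <? p)); lia.
  - intros eps Heps. destruct (archimed_cor1 eps Heps) as [M [HM HM0]].
    (* M gives eps * n >= 1, which absorbs an additive error 1; 2^e forces k >= 1, so the scale 2^(e
       k) is an even number 2z. *)
    exists (M + 2 ^ e)%nat. intros n Hn.
    assert (HMn : 1 <= eps * INR n).
    { assert (INR M <= INR n) by (apply le_INR; lia).
      assert (0 < INR M) by (apply lt_0_INR; lia).
      apply Rmult_lt_compat_r with (r := INR M) in HM; [|assumption].
      rewrite Rinv_l in HM by lra. nra. }
    destruct (lead_exists e n He) as [k Hk]; [lia|].
    assert (Hk0 : (0 < k)%nat).
    { destruct k; [|lia]. rewrite Nat.mul_1_r in Hk. lia. }
    assert (Hz : exists z, (2 ^ (e * k) = 2 * z)%nat).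
    { exists (2 ^ (e * k - 1))%nat. rewrite <- Nat.pow_succ_r'. f_equal. nia. }
    destruct Hz as [z Hz].
    assert (Hzp : (0 < z)%nat) by (pose proof (Nat.pow_nonzero 2 (e * k)); lia).
    assert (Hsk : (2 ^ (e * S k) = 2 * z * 2 ^ e)%nat).
    { rewrite Nat.mul_succ_r, Nat.pow_add_r, Hz. reflexivity. }
    pose proof (lead_eq e k n He Hk) as Hl. rewrite Hz in Hl.
    (* Inside a zero interval the next 1 is at p * 2^(e k) + 1, the first odd position beyond its
       end. Outside, the digit is the parity: an even n has the same leading digit as n + 1, and an
       odd n already carries a 1. *)
    destruct (classic (q <= lead e n < p)%nat) as [[Hq1 Hp1]|Hg];
      [|destruct (Nat.Even_or_Odd n) as [[u Hu]|[u Hu]]].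
    + assert (Hle : (q * (2 * z) <= n < p * (2 * z))%nat).
      { rewrite Hl in Hq1, Hp1. split.
        - pose proof (Nat.Div0.mul_div_le n (2 * z)). nia.
        - pose proof (Nat.mul_succ_div_gt n (2 * z)). nia. }
      exists (p * (2 * z) + 1 - n)%nat.
      replace (n + (p * (2 * z) + 1 - n))%nat with (p * (2 * z) + 1)%nat by lia. split.
      * rewrite Hdodd.
        -- replace (p * (2 * z) + 1)%nat with (1 + (p * z) * 2)%nat by lia.
           apply Nat.Div0.mod_add.
        -- rewrite (lead_eq e k), Hz by (rewrite ?Hz, ?Hsk; nia).
           replace (p * (2 * z) + 1)%nat with (1 + p * (2 * z))%nat by lia.
           rewrite Nat.div_add by lia. lia.
      * rewrite minus_INR, plus_INR, mult_INR by lia. simpl (INR 1).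
        destruct Hle as [Hle _]. apply le_INR in Hle. rewrite mult_INR in Hle.
        assert (INR p * INR (2 * z) <= v * INR n).
        { rewrite <- Hv1, Rmult_assoc. apply Rmult_le_compat_l; lra. }
        lra.
    + exists 1%nat. rewrite Nat.add_1_r, Hdodd; [split|].
      * rewrite Hu. symmetry. apply (Nat.mod_unique _ _ u); lia.
      * pose proof (pos_INR n). simpl (INR 1). nra.
      * rewrite (lead_eq e k), Hz by (rewrite ?Hz, ?Hsk in *; nia).
        replace (S n / (2 * z))%nat with (n / (2 * z))%nat; [lia|].
        rewrite <- !Nat.Div0.div_div. f_equal.
        rewrite Hu, <- (Nat.div_unique (2 * u) 2 u 0), <- (Nat.div_unique (S (2 * u)) 2 u 1) by lia.
        reflexivity.
    + exists 0%nat. rewrite Nat.add_0_r, Hdodd, Hu by assumption. split.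
      * symmetry. apply (Nat.mod_unique _ _ u); lia.
      * pose proof (pos_INR (2 * u + 1)). simpl (INR 0). nra.
  (* The whole zero interval at scale S N: its length is exactly v - 1 times its starting point. *)
  - intros eps Heps N. exists (q * 2 ^ (e * S N))%nat, ((p - q) * 2 ^ (e * S N))%nat.
    assert (HN : (N < 2 ^ (e * S N))%nat).
    { apply Nat.lt_le_trans with (2 ^ S N)%nat.
      - pose proof (Nat.pow_gt_lin_r 2 (S N)). lia.
      - apply Nat.pow_le_mono_r; nia. }
    split; [nia|split; [nia|split]].
    + intros j Hj. apply (Hd0 (S N)). rewrite Nat.mul_sub_distr_r in Hj. lia.
    + rewrite !mult_INR, minus_INR by assumption.
      rewrite <- Hv1. pose proof (Rmult_le_pos _ _ (pos_INR q) (pos_INR (2 ^ (e * S N)))). nra.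
  - exists (tail b d 0), d. split; [exact E1|split; [|exact E2]].
    apply lead_parity_automatic; [assumption|]. intro c. specialize (Htau c). lia.
Qed.

(** * Words with marked blocks *)

(** A summation argument of Stolz-Cesaro type: B(k+1) - v B(k) changes at each step by N(k+1) - v
    N(k) + (1 - v), which is small relative to N(k), and the N(k) sum to at most B. *)
Lemma block_ends_ratio (v : R) (N B : nat -> nat) : 1 < v ->
  (forall k, (1 <= N k)%nat) -> (forall k, B (S k) = (B k + S (N k))%nat) ->
  (forall K : nat, exists n1, forall k, (n1 <= k)%nat ->
     INR K * Rabs (INR (N (S k)) - v * INR (N k)) <= INR (N k)) ->
  forall eps, 0 < eps -> exists k0, forall k, (k0 <= k)%nat ->
    Rabs (INR (B (S k)) - v * INR (B k)) <= eps * INR (B k).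
Proof.
  intros Hv HN HB Hlim eps Heps.
  assert (Hlim' : forall delta, 0 < delta -> exists n1, forall k, (n1 <= k)%nat ->
     Rabs (INR (N (S k)) - v * INR (N k)) <= delta * INR (N k)).
  { intros delta Hdelta. destruct (archimed_cor1 delta Hdelta) as [K [HK HK0]].
    destruct (Hlim K) as [n1 Hn1]. exists n1. intros k Hk. specialize (Hn1 k Hk).
    assert (HK1 : 0 < INR K) by (apply lt_0_INR; lia).
    apply Rmult_le_reg_l with (INR K); [assumption|].
    apply Rle_trans with (1 := Hn1). rewrite <- Rmult_assoc.
    rewrite <- (Rmult_1_l (INR (N k))) at 1. apply Rmult_le_compat_r; [apply pos_INR|].
    apply Rmult_lt_compat_l with (r := INR K) in HK; [|assumption].
    rewrite Rinv_r in HK by lra. lra. }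
  (* With relative error (v - 1) / 2 the integers N(k) increase strictly from some index on, hence
     tend to infinity. *)
  assert (Hgrow : exists n1, forall j, (j <= N (n1 + j))%nat).
  { destruct (Hlim' ((v - 1) / 2) ltac:(lra)) as [n1 Hn1]. exists n1.
    induction j as [|j IH]; [lia|].
    specialize (Hn1 (n1 + j)%nat ltac:(lia)).
    rewrite Nat.add_succ_r. apply Rabs_le_between in Hn1.
    assert (INR (N (n1 + j)%nat) < INR (N (S (n1 + j)))).
    { assert (1 <= INR (N (n1 + j)%nat)) by (apply (le_INR 1), HN). nra. }
    apply INR_lt in H. lia. }
  assert (HBk : forall k, (k <= B k)%nat).
  { induction k as [|k IH]; [lia|]. rewrite HB. lia. }
  (* One delta for the error in the ratio of the N(k), one for the constant v - 1, and one for the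
     initial value of D. *)
  pose (delta := eps / 3).
  assert (Hdelta : 0 < delta) by (unfold delta; lra).
  destruct Hgrow as [n1 Hn1]. destruct (Hlim' delta Hdelta) as [n2 Hn2].
  destruct (INR_unbounded ((v - 1) / delta)) as [M HM].
  pose (k0 := (n2 + (n1 + M))%nat).
  pose (D k := INR (B (S k)) - v * INR (B k)).
  assert (Hstep : forall k, (k0 <= k)%nat ->
     Rabs (D (S k)) <= Rabs (D k) + 2 * delta * (INR (B (S k)) - INR (B k))).
  { intros k Hk. specialize (Hn2 k ltac:(unfold k0 in Hk; lia)).
    assert (HNk : INR M <= INR (N k)).
    { apply le_INR. specialize (Hn1 (k - n1)%nat).
      replace (n1 + (k - n1))%nat with k in Hn1 by (unfold k0 in Hk; lia).
      unfold k0 in Hk. lia. }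
    assert (Hc : v - 1 <= delta * INR (N k)).
    { apply Rmult_lt_compat_l with (r := delta) in HM; [|assumption].
      replace (delta * ((v - 1) / delta)) with (v - 1) in HM by (field; lra). nra. }
    assert (ED : D (S k) = D k + (INR (N (S k)) - v * INR (N k) + (1 - v))).
    { unfold D. rewrite (HB (S k)), !(HB k), !plus_INR, !S_INR. ring. }
    rewrite ED. apply Rle_trans with (1 := Rabs_triang _ _).
    apply Rplus_le_compat_l. apply Rle_trans with (1 := Rabs_triang _ _).
    rewrite (Rabs_left (1 - v)) by lra.
    rewrite HB, plus_INR, S_INR. lra. }
  assert (Hacc : forall j, Rabs (D (k0 + j)%nat)
     <= Rabs (D k0) + 2 * delta * (INR (B (k0 + j)%nat) - INR (B k0))).
  { induction j as [|j IH].
    - rewrite Nat.add_0_r. lra.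
    - rewrite Nat.add_succ_r. specialize (Hstep (k0 + j)%nat ltac:(lia)). lra. }
  destruct (INR_unbounded (Rabs (D k0) / delta)) as [M' HM'].
  exists (k0 + M')%nat. intros k Hk. fold (D k).
  specialize (Hacc (k - k0)%nat). replace (k0 + (k - k0))%nat with k in Hacc by lia.
  assert (HM2 : INR M' <= INR (B k)) by (apply le_INR; specialize (HBk k); lia).
  apply Rlt_le, Rmult_le_compat_l with (r := delta) in HM'; [|lra].
  replace (delta * (Rabs (D k0) / delta)) with (Rabs (D k0)) in HM' by (field; lra).
  pose proof (pos_INR (B k0)). unfold delta in *. nra.
Qed.

(** * Morphic words whose blocks have prescribed lengths *)

Section MarkedBlocks.
Variables (K : nat) (succ : nat -> list nat) (L : nat -> nat -> nat).
Hypothesis (K_pos : (0 < K)%nat).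
Hypothesis (succ_lt : forall i j, (i < K)%nat -> In j (succ i) -> (j < K)%nat).
Hypothesis (L_pos : forall k i, (i < K)%nat -> (1 <= L k i)%nat).
Hypothesis (L_succ : forall k i, (i < K)%nat -> L (S k) i = list_sum (map (L k) (succ i))).

(* The letter 0 starts the word, 1 marks the beginning of a block, 2 is an erased
   filler giving the state [i], encoded by the letter [3 + i], its initial length [L 0 i]. *)
Definition expand (i : nat) : list nat := S (S (S i)) :: repeat 2%nat (L 0 i - 1).

(** Since the marker 1 is fixed, h^(k+1)(0) is h^k(0) followed by 1 and by h^k([expand 0]). The
    latter has length [L k 0] and contains no marker, so it becomes the k-th run of zeros. *)
Definition block_morphism (x : nat) : list nat :=
  match x with
  | 0 => 0 :: 1 :: expand 0
  | 1 => [1]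
  | 2 => []
  | S (S (S i)) => flat_map expand (succ i)
  end%nat.

Lemma morph_iter_nil h k : morph_iter h k [] = [].
Proof.
  induction k as [|k IH]; [reflexivity|].
  change (morph_apply h (morph_iter h k []) = []). rewrite IH. reflexivity.
Qed.

Lemma morph_iter_flat_map h k (f : nat -> list nat) l :
  morph_iter h k (flat_map f l) = flat_map (fun j => morph_iter h k (f j)) l.
Proof.
  induction l as [|x l IH]; simpl; [apply morph_iter_nil|].
  rewrite morph_iter_app, IH. reflexivity.
Qed.

(** The fillers vanish and the state letter creates those of its successors, so the lengths satisfy
    the recursion [L_succ] with the right initial values [L 0 i]. *)
Lemma expand_step i : morph_apply block_morphism (expand i) = flat_map expand (succ i).
Proof.
  unfold morph_apply, expand at 1. simpl.
  rewrite <- (app_nil_r (flat_map expand (succ i))) at 2. f_equal.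
  induction (L 0 i - 1)%nat as [|l IH]; [reflexivity|]. exact IH.
Qed.

Lemma length_iter_expand k i : (i < K)%nat ->
  length (morph_iter block_morphism k (expand i)) = L k i.
Proof.
  revert i. induction k as [|k IH]; intros i Hi.
  - simpl. rewrite repeat_length. specialize (L_pos 0 i Hi). lia.
  - rewrite morph_iter_succ_r, expand_step, morph_iter_flat_map, length_flat_map, L_succ by assumption.
    f_equal. apply map_ext_in. intros j Hj. apply IH. apply (succ_lt i); assumption.
Qed.

Lemma iter_expand_ge2 k i y : In y (morph_iter block_morphism k (expand i)) -> (2 <= y)%nat.
Proof.
  revert i y. induction k as [|k IH]; intros i y Hy.
  - destruct Hy as [<-|Hy]; [lia|]. apply repeat_spec in Hy. lia.
  - rewrite morph_iter_succ_r, expand_step, morph_iter_flat_map in Hy.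
    apply in_flat_map in Hy. destruct Hy as [j [_ Hy]]. apply (IH j y Hy).
Qed.

Definition block_prefix (k : nat) : list nat := morph_iter block_morphism k [0%nat].

Lemma morph_iter_marker k : morph_iter block_morphism k [1%nat] = [1%nat].
Proof.
  induction k as [|k IH]; [reflexivity|].
  change (morph_apply block_morphism (morph_iter block_morphism k [1%nat]) = [1%nat]).
  rewrite IH. reflexivity.
Qed.

Lemma block_prefix_succ k :
  block_prefix (S k) = block_prefix k ++ 1%nat :: morph_iter block_morphism k (expand 0).
Proof.
  unfold block_prefix. rewrite morph_iter_succ_r.
  change (morph_apply block_morphism [0%nat]) with ([0%nat] ++ ([1%nat] ++ (expand 0 ++ []))).
  rewrite !morph_iter_app, morph_iter_marker, morph_iter_nil, app_nil_r. reflexivity.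
Qed.

Lemma length_block_prefix_succ k :
  length (block_prefix (S k)) = (length (block_prefix k) + S (L k 0))%nat.
Proof.
  rewrite block_prefix_succ, length_app. simpl. rewrite length_iter_expand by assumption. lia.
Qed.

Lemma length_block_prefix_gt k : (k < length (block_prefix k))%nat.
Proof.
  induction k as [|k IH]; [simpl; lia|]. rewrite length_block_prefix_succ. lia.
Qed.

(** The prefix of index i is longer than i, so the default value of [nth] is never reached. *)
Definition block_word (i : nat) : nat := nth i (block_prefix i) 0%nat.

Lemma block_wordE k i : (i < length (block_prefix k))%nat ->
  block_word i = nth i (block_prefix k) 0%nat.
Proof.
  assert (P : forall m j, (i < length (block_prefix m))%nat ->
    nth i (block_prefix (m + j)) 0%nat = nth i (block_prefix m) 0%nat).
  { intros m j Hm. induction j as [|j IH]; [rewrite Nat.add_0_r; reflexivity|].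
    rewrite Nat.add_succ_r, block_prefix_succ, app_nth1; [exact IH|].
    clear IH. induction j as [|j IH]; [rewrite Nat.add_0_r; exact Hm|].
    rewrite Nat.add_succ_r, length_block_prefix_succ. lia. }
  intro Hk. unfold block_word. destruct (Nat.le_ge_cases i k) as [H|H].
  - rewrite <- (P i (k - i)%nat) by apply length_block_prefix_gt. do 2 f_equal. lia.
  - rewrite <- (P k (i - k)%nat) by assumption. do 2 f_equal. lia.
Qed.

Lemma block_word_marker k : block_word (length (block_prefix k)) = 1%nat.
Proof.
  rewrite (block_wordE (S k)) by (rewrite length_block_prefix_succ; lia).
  rewrite block_prefix_succ, app_nth2, Nat.sub_diag by lia. reflexivity.
Qed.

Lemma block_word_inside k j : (j < L k 0)%nat ->
  (2 <= block_word (length (block_prefix k) + S j))%nat.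
Proof.
  intro Hj.
  rewrite (block_wordE (S k)) by (rewrite length_block_prefix_succ; lia).
  rewrite block_prefix_succ, app_nth2 by lia.
  replace (length (block_prefix k) + S j - length (block_prefix k))%nat with (S j) by lia.
  simpl. apply (iter_expand_ge2 k 0), nth_In. rewrite length_iter_expand by assumption. exact Hj.
Qed.

Definition block_digit (i : nat) : nat := if Nat.eqb (block_word i) 1 then 1%nat else 0%nat.

Lemma block_digit_morphic b : (2 <= b)%nat -> is_morphic b block_digit.
Proof.
  intro Hb.
  exists (3 + K)%nat, block_morphism, 0%nat, (fun x => if Nat.eqb x 1 then 1%nat else 0%nat), block_word.
  assert (He : forall i y, (i < K)%nat -> In y (expand i) -> (y < 3 + K)%nat).
  { intros i y Hi [<-|Hy]; [lia|]. apply repeat_spec in Hy. lia. }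
  split; [|split; [|split; [|split]]].
  - intros [|[|[|i]]] Hi y Hy; simpl in Hy.
    + destruct Hy as [<-|[<-|Hy]]; [lia|lia|]. apply (He 0%nat y K_pos Hy).
    + destruct Hy as [<-|[]]. lia.
    + destruct Hy.
    + apply in_flat_map in Hy. destruct Hy as [j [Hj Hy]]. apply (He j y); [|exact Hy].
      apply (succ_lt i); [lia|exact Hj].
  - split; [lia|]. exists (1%nat :: expand 0). split; [reflexivity|split; [discriminate|]].
    (* Although fillers are erased, the marker survives every iteration, so no iterate is empty. *)
    intros n H. change (1%nat :: expand 0) with ([1%nat] ++ expand 0) in H.
    rewrite morph_iter_app, morph_iter_marker in H. discriminate.
  - intros n i Hi. apply block_wordE. exact Hi.
  - intros c _. destruct (Nat.eqb c 1); lia.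
  - reflexivity.
Qed.

Lemma block_digit_marker k : block_digit (length (block_prefix k)) = 1%nat.
Proof. unfold block_digit. rewrite block_word_marker. reflexivity. Qed.

Lemma block_digit_inside k j : (j < L k 0)%nat ->
  block_digit (length (block_prefix k) + S j) = 0%nat.
Proof.
  intro Hj. apply block_word_inside in Hj. unfold block_digit.
  destruct (Nat.eqb_spec (block_word (length (block_prefix k) + S j)) 1); lia.
Qed.

Lemma block_exists n : (1 <= n)%nat ->
  exists k, (length (block_prefix k) <= n < length (block_prefix (S k)))%nat.
Proof.
  intro Hn. induction n as [|n IH]; [lia|].
  destruct n as [|n].
  - exists 0%nat. rewrite length_block_prefix_succ. simpl (length (block_prefix 0)).
    specialize (L_pos 0 0 K_pos). lia.
  - destruct IH as [k Hk]; [lia|].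
    destruct (Nat.lt_ge_cases (S (S n)) (length (block_prefix (S k)))) as [H|H].
    + exists k. lia.
    + exists (S k). rewrite (length_block_prefix_succ (S k)). lia.
Qed.

(** The digits 1 sit exactly at the positions B(k) = |h^k(0)|, and B(k+1) / B(k) tends to v by
    [block_ends_ratio]. From n in block k the next marker is at most B(k+1) - n away, and the run
    after the marker at B(k) has length B(k+1) - B(k) - 1. *)
Lemma vb_of_block_word (v : R) (b : nat) : 1 < v -> (2 <= b)%nat ->
  (forall M : nat, exists n1, forall k, (n1 <= k)%nat ->
     INR M * Rabs (INR (L (S k) 0) - v * INR (L k 0)) <= INR (L k 0)) ->
  is_base_expansion b (tail b block_digit 0) block_digit /\
  vb_eq b (tail b block_digit 0) (v - 1).
Proof.
  intros Hv Hb Hlim.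
  set (B k := length (block_prefix k)).
  assert (HB : forall k, B (S k) = (B k + S (L k 0))%nat) by (intro; apply length_block_prefix_succ).
  assert (HBk : forall k, (k < B k)%nat) by apply length_block_prefix_gt.
  pose proof (block_ends_ratio v (fun k => L k 0) B Hv (fun k => L_pos k 0 K_pos) HB Hlim) as Hratio.
  apply vb_of_zero_runs; [assumption|lra| | | |].
  - intro n. unfold block_digit. destruct (Nat.eqb (block_word n) 1); lia.
  - intro n. destruct n as [|n]; [left; reflexivity|].
    destruct (block_exists (S n)) as [k [H1 H2]]; [lia|].
    rewrite length_block_prefix_succ in H2.
    destruct (Nat.eq_dec (S n) (length (block_prefix k))) as [E|E].
    + right. rewrite E, <- Nat.add_1_r. apply block_digit_inside. apply L_pos, K_pos.
    + left. replace (S n) with (length (block_prefix k) + S (n - length (block_prefix k)))%nat by lia.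
      apply block_digit_inside. lia.
  - intros eps Heps. destruct (Hratio eps Heps) as [k0 Hk0].
    exists (B k0). intros n Hn.
    destruct (block_exists n) as [k [H1 H2]]; [specialize (HBk k0); lia|].
    fold (B k) in H1. fold (B (S k)) in H2.
    exists (B (S k) - n)%nat. replace (n + (B (S k) - n))%nat with (B (S k)) by lia.
    split; [apply block_digit_marker|].
    assert (Hkk : (k0 <= k)%nat).
    { apply Nat.nlt_ge. intro Hlt.
      assert (Hmono : forall j, (B (S k) <= B (S k + j))%nat).
      { induction j as [|j IH]; [rewrite Nat.add_0_r; lia|]. rewrite Nat.add_succ_r, (HB (S k + j)%nat). lia. }
      specialize (Hmono (k0 - S k)%nat). replace (S k + (k0 - S k))%nat with k0 in Hmono by lia. lia. }
    specialize (Hk0 k Hkk). apply Rabs_le_between in Hk0.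
    rewrite minus_INR by lia. apply le_INR in H1. nra.
  - intros eps Heps N. destruct (Hratio (eps / 2) ltac:(lra)) as [k0 Hk0].
    (* For B(k) >= M the second eps / 2 covers the constant loss, at most v, caused by starting at
       B(k) + 1 and by the marker. *)
    destruct (INR_unbounded (2 * v / eps)) as [M HM].
    pose (k := (k0 + (M + N))%nat). exists (S (B k)), (L k 0).
    split; [specialize (HBk k); unfold k in *; lia|split; [lia|split]].
    + intros j Hj. replace (S (B k) + j)%nat with (length (block_prefix k) + S j)%nat.
      * apply block_digit_inside, Hj.
      * fold (B k). lia.
    + specialize (Hk0 k ltac:(unfold k; lia)). apply Rabs_le_between in Hk0.
      rewrite HB, plus_INR, S_INR in Hk0. rewrite S_INR.
      assert (HMB : INR M <= INR (B k)) by (apply le_INR; specialize (HBk k); unfold k in *; lia).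
      apply Rmult_lt_compat_l with (r := eps / 2) in HM; [|lra].
      replace (eps / 2 * (2 * v / eps)) with v in HM by (field; lra). nra.
Qed.

End MarkedBlocks.

(** * From nonnegative recurrences to a morphic word *)

Lemma list_sum_map_repeat (f : nat -> nat) x t : list_sum (map f (repeat x t)) = (t * f x)%nat.
Proof. induction t as [|t IH]; [reflexivity|]. simpl. rewrite IH. reflexivity. Qed.

Lemma list_sum_map_flat_map (f : nat -> nat) (g : nat -> list nat) l :
  list_sum (map f (flat_map g l)) = list_sum (map (fun i => list_sum (map f (g i))) l).
Proof.
  induction l as [|x l IH]; [reflexivity|]. simpl. rewrite map_app, list_sum_app, IH. reflexivity.
Qed.

(* The state [i * m + j] carries the sequence [fun k => A i (j + k)], so that one step of
   [L] advances [k] by 1 while the recurrences for [A] advance it by [m]. *)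
Lemma morphic_of_system (v : R) (b m n t : nat) (c : nat -> nat) (A : nat -> nat -> nat) :
  1 < v -> (2 <= b)%nat -> (0 < m)%nat ->
  (forall i k, (i < n)%nat -> A i (k + m)%nat = (t * A i k + A (S i) k)%nat) ->
  (forall k, A n (k + m)%nat =
     (t * A n k + list_sum (map (fun i => c i * A i k)%nat (seq 0 (S n))))%nat) ->
  (forall i k, (i <= n)%nat -> (1 <= A i k)%nat) ->
  (forall K : nat, exists n1, forall k, (n1 <= k)%nat ->
     INR K * Rabs (INR (A 0%nat (S k)) - v * INR (A 0%nat k)) <= INR (A 0%nat k)) ->
  exists (xi : R) (d : nat -> nat),
    is_base_expansion b xi d /\ is_morphic b d /\ vb_eq b xi (v - 1).
Proof.
  intros Hv Hb Hm HA HAn Hpos Hlim.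
  pose (L k x := A (x / m)%nat (x mod m + k)%nat).
  (* A state (i, j) with j + 1 < m only advances j. For j = m - 1 a recurrence applies: [S x] is
     then the state (i + 1, 0), and [x / m * m] is (i, 0), taken t times; for i = n the coefficients
     [c] give the multiplicities. *)
  pose (succ x := if S (x mod m) <? m then [S x]
    else if x / m <? n then S x :: repeat (x / m * m)%nat t
    else repeat (n * m)%nat t ++ flat_map (fun i => repeat (i * m)%nat (c i)) (seq 0 (S n))).
  assert (HL0 : forall i k, L k (i * m)%nat = A i k).
  { intros i k. unfold L. rewrite Nat.div_mul, Nat.Div0.mod_mul by lia. reflexivity. }
  assert (Hdm : forall x, exists i j, x = (i * m + j)%nat /\ (j < m)%nat /\
     (x / m = i)%nat /\ (x mod m = j)%nat).
  { intro x. exists (x / m)%nat, (x mod m)%nat. pose proof (Nat.div_mod_eq x m).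
    pose proof (Nat.mod_upper_bound x m). repeat split; lia. }
  assert (Hlt : forall x y, (x < S n * m)%nat -> In y (succ x) -> (y < S n * m)%nat).
  { intros x y Hx Hy. destruct (Hdm x) as [i [j [Ex [Hj [Ei Ej]]]]].
    unfold succ in Hy. rewrite Ei, Ej in Hy.
    assert (Hin : (i <= n)%nat) by nia.
    destruct (Nat.ltb_spec (S j) m); [destruct Hy as [<-|[]]; nia|].
    destruct (Nat.ltb_spec i n).
    - destruct Hy as [<-|Hy]; [nia|]. apply repeat_spec in Hy. nia.
    - apply in_app_or in Hy. destruct Hy as [Hy|Hy]; [apply repeat_spec in Hy; nia|].
      apply in_flat_map in Hy. destruct Hy as [i' [Hi' Hy]].
      apply repeat_spec in Hy. apply in_seq in Hi'. nia. }
  assert (HLs : forall k x, (x < S n * m)%nat -> L (S k) x = list_sum (map (L k) (succ x))).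
  { intros k x Hx. destruct (Hdm x) as [i [j [Ex [Hj [Ei Ej]]]]].
    unfold succ. rewrite Ei, Ej.
    assert (Hin : (i <= n)%nat) by nia.
    replace (L (S k) x) with (A i (j + S k)%nat) by (unfold L; rewrite Ei, Ej; reflexivity).
    destruct (Nat.ltb_spec (S j) m).
    - simpl. unfold L.
      assert (ES : S x = (m * i + S j)%nat) by (rewrite Ex, Nat.mul_comm; lia).
      rewrite <- (Nat.div_unique (S x) m i (S j)), <- (Nat.mod_unique (S x) m i (S j)) by assumption.
      rewrite Nat.add_0_r. f_equal. lia.
    - replace (j + S k)%nat with (k + m)%nat by lia.
      destruct (Nat.ltb_spec i n) as [H1|H1].
      + change (list_sum (map ?f (?a :: ?l))) with (f a + list_sum (map f l))%nat.
        rewrite list_sum_map_repeat, HL0, HA by assumption.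
        replace (S x) with (S i * m)%nat by nia. rewrite HL0. lia.
      + rewrite map_app, list_sum_app, list_sum_map_repeat, list_sum_map_flat_map, HL0.
        replace i with n by lia. rewrite HAn. do 2 f_equal.
        apply map_ext. intro i'. rewrite list_sum_map_repeat, HL0. reflexivity. }
  assert (HLp : forall k x, (x < S n * m)%nat -> (1 <= L k x)%nat).
  { intros k x Hx. destruct (Hdm x) as [i [j [Ex [Hj [Ei Ej]]]]].
    apply Hpos. rewrite Ei. nia. }
  assert (HK : (0 < S n * m)%nat) by nia.
  exists (tail b (block_digit succ L) 0), (block_digit succ L).
  destruct (vb_of_block_word _ succ L HK Hlt HLp HLs v b Hv Hb) as [E1 E2].
  - intro M. destruct (Hlim M) as [n1 Hn1]. exists n1. intros k Hk.
    rewrite <- (Nat.mul_0_l m), !HL0. apply Hn1, Hk.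
  - split; [exact E1|split; [|exact E2]].
    apply (block_digit_morphic _ succ L HK Hlt HLp HLs). exact Hb.
Qed.

(** * Perron numbers and nonnegative integer recurrences *)

(** Take t just above K rho^r. As rho^r >= 1, t <= (K + 1) rho^r, and K (K + 1) rho^r < v^r once (v
    / rho)^r >= K (K + 1) + 1. *)
Lemma geometric_gap (v rho : R) : 1 <= rho < v ->
  forall K : nat, exists r0, forall r, (r0 <= r)%nat -> exists t : nat,
    INR K * rho ^ r <= INR t /\ INR K * INR t < v ^ r.
Proof.
  intros Hrho K.
  assert (Hx : Rabs (v / rho) > 1).
  { rewrite Rabs_right.
    - apply Rmult_lt_reg_r with rho; [lra|]. unfold Rdiv. rewrite Rmult_assoc, Rinv_l; lra.
    - apply Rle_ge, Rlt_le, Rdiv_lt_0_compat; lra. }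
  destruct (Pow_x_infinity _ Hx (INR K * (INR K + 1) + 1)) as [r0 Hr0].
  exists r0. intros r Hr. specialize (Hr0 r Hr).
  assert (Hp : 1 <= rho ^ r) by (apply pow_R1_Rle; lra).
  rewrite <- RPow_abs, Rabs_right in Hr0 by
    (apply Rle_ge, Rlt_le, Rdiv_lt_0_compat; lra).
  unfold Rdiv in Hr0. rewrite Rpow_mult_distr, pow_inv in Hr0.
  apply Rge_le, Rmult_le_compat_r with (r := rho ^ r) in Hr0; [|lra].
  rewrite Rmult_assoc, Rinv_l, Rmult_1_r in Hr0 by lra.
  destruct (archimed (INR K * rho ^ r)) as [A1 A2].
  assert (HK : 0 <= INR K) by apply pos_INR.
  assert (Hu : (0 <= up (INR K * rho ^ r))%Z) by (apply le_IZR; nra).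
  exists (Z.to_nat (up (INR K * rho ^ r))).
  rewrite (INR_IZR_INZ (Z.to_nat _)), Z2Nat.id by assumption.
  split; [lra|]. nra.
Qed.

Module Algebra.
Import all_boot all_order all_algebra ring lra.
Set Implicit Arguments. Unset Strict Implicit. Unset Printing Implicit Defensive.
Import Order.TTheory GRing.Theory Num.Theory.
Local Open Scope ring_scope.

(** * Integrality of power sums, and polynomials for powers of the roots *)

Section DominantRoot.
Variable C : numClosedFieldType.
Notation pZ := (map_poly (intr : int -> C)).
Notation prodX s := (\prod_(x <- s) ('X - x%:P)).

(** With P = [prodX s], P' is the sum of the P / (X - x), so P' f is congruent modulo P to the sum
    of the f(x) P / (X - x). Each P / (X - x) is monic of degree |s| - 1, which gives the top
    coefficient. *)
Lemma deriv_prodX_mod (s : seq C) (f : {poly C}) :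
  exists k r : {poly C}, [/\ (prodX s)^`() * f = prodX s * k + r,
    (size r <= size s)%N & r`_(size s).-1 = \sum_(x <- s) f.[x]].
Proof.
elim: s => [|x s [k [r [E Sr Er]]]].
  by exists 0, 0; rewrite !big_nil derivC mul0r mulr0 addr0 size_poly0 coef0.
have [g Eg] : exists g, f = g * ('X - x%:P) + f.[x]%:P.
  have /factor_theorem [g Eg] : root (f - f.[x]%:P) x.
    by rewrite /root !hornerE subrr.
  by exists g; rewrite -Eg subrK.
exists (g + k), (f.[x] *: prodX s + ('X - x%:P) * r).
have Sp : size (prodX s) = (size s).+1 by rewrite size_prod_XsubC.
have Mp : (prodX s)`_(size s) = 1.
  by have /monicP := monic_prod_XsubC s xpredT id; rewrite /lead_coef Sp.
split.
- rewrite !big_cons derivM derivXsubC mul1r mulrDl -[X in _ + X]mulrA E.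
  rewrite {1}Eg -mul_polyC; ring.
- apply: leq_trans (size_polyD _ _) _; rewrite geq_max; apply/andP; split.
    by apply: leq_trans (size_scale_leq _ _) _; rewrite Sp.
  have [->|r0] := eqVneq r 0; first by rewrite mulr0 size_poly0.
  by rewrite mulrC size_Mmonic ?monicXsubC // size_XsubC addn2 /= ltnS.
- rewrite big_cons -Er coefD coefZ Mp mulr1 mulrBl coefB coefXM coefCM /=.
  rewrite [X in _ - _ * X](_ : _ = 0) ?mulr0 ?subr0; last by rewrite nth_default.
  by case: (s) Sr => [|y s'] //=; rewrite leqn0 size_poly_eq0 => /eqP->; rewrite coef0.
Qed.

(** The remainder of p' f modulo the monic integer polynomial p has integer coefficients, and by
    [deriv_prodX_mod] its top one is the sum. No symmetric functions enter. *)
Lemma power_sum_int (p : {poly int}) (s : seq C) (f : {poly int}) :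
  pZ p = prodX s -> exists z : int, z%:~R = \sum_(x <- s) (pZ f).[x].
Proof.
move=> Ep.
have Sp : size p = (size s).+1.
  by rewrite -(size_map_inj_poly (intr_inj (R := C))) // Ep size_prod_XsubC.
have Mp : p \is monic.
  apply/monicP/(intr_inj (R := C)); rewrite -(lead_coef_map_inj (intr_inj (R := C))) //.
  by rewrite Ep (monicP (monic_prod_XsubC s xpredT id)).
have [k [r [E Sr <-]]] := deriv_prodX_mod s (pZ f).
pose F := p^`() * f.
have EF := Pdiv.RingMonic.rdivp_eq Mp F.
exists (Pdiv.Ring.rmodp F p)`_(size s).-1.
rewrite -coef_map; congr (_`_ _).
have P0 : size (pZ p) = (size s).+1 by rewrite Ep size_prod_XsubC.
transitivity (pZ F %% pZ p).
  rewrite {2}EF rmorphD rmorphM /= modp_addl_mul_small // P0 ltnS.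
  apply: leq_trans (size_poly _ _) _; rewrite -ltnS -Sp.
  by rewrite Pdiv.Ring.ltn_rmodpN0 // monic_neq0.
rewrite rmorphM /= -deriv_map Ep E mulrC modp_addl_mul_small //.
by rewrite size_prod_XsubC ltnS.
Qed.

(* Graeffe: p(X) p(-X) is even. *)
Lemma graeffe (p : {poly int}) (s : seq C) :
  pZ p = prodX s -> exists q : {poly int}, pZ q = prodX [seq x ^+ 2 | x <- s].
Proof.
move=> Ep.
pose q0 := p * (p \Po (- 'X)).
have Eq0 : pZ q0 = (-1) ^+ size s *: (prodX [seq x ^+ 2 | x <- s] \Po 'X^2).
  rewrite rmorphM /= map_comp_poly rmorphN /= map_polyX Ep big_map.
  elim: s {Ep} => [|x s IH]; first by rewrite !big_nil !comp_polyC mulr1 scale1r.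
  rewrite !big_cons !comp_polyM mulrACA IH /= [(-1) ^+ _.+1]exprS mulN1r scaleNr.
  rewrite !comp_polyB !comp_polyX !comp_polyC -!mul_polyC rmorphXn /=.
  by rewrite expr2; ring.
have E2 : even_poly (pZ q0) = (-1) ^+ size s *: prodX [seq x ^+ 2 | x <- s].
  rewrite Eq0 even_polyZ; congr (_ *: _); apply/polyP => i.
  by rewrite coef_even_poly -muln2 coef_comp_poly_Xn // dvdn_mull //= mulnK.
exists ((-1) ^+ size s *: even_poly q0).
rewrite map_polyZ /= rmorphXn rmorphN1.
have -> : pZ (even_poly q0) = even_poly (pZ q0).
  by apply/polyP => i; rewrite coef_map !coef_even_poly coef_map.
by rewrite E2 scalerA -exprMn mulrNN mulr1 expr1n scale1r.
Qed.

Lemma graeffe_iter (p : {poly int}) (s : seq C) r :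
  pZ p = prodX s -> exists q : {poly int}, pZ q = prodX [seq x ^+ (2 ^ r) | x <- s].
Proof.
move=> Ep; elim: r => [|r [q Eq]]; first by exists p; rewrite Ep big_map.
have [q' Eq'] := graeffe Eq; exists q'; rewrite Eq' -map_comp.
by congr (\prod_(x <- _) _); apply: eq_map => x /=; rewrite -exprM expnSr.
Qed.

(** * Coefficient estimates for products of nearly equal linear factors *)

Lemma coef_XaddC_exp_ge0 (t : C) n j : 0 <= t -> 0 <= (('X + t%:P) ^+ n)`_j.
Proof.
move=> t0; elim: n j => [|n IHn] j; first by rewrite expr0 coef1 ler0n.
rewrite exprS mulrDl coefD coefXM coefCM addr_ge0 ?mulr_ge0 //.
by case: (j == 0%N).
Qed.

(** Each coefficient is a polynomial in the a's with nonnegative coefficients. Expanding around t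
    and bounding every |a - t| by e majorizes the change by that at a = t + e. *)
Lemma coef_prod_XaddC_le (t e : C) (s : seq C) (j : nat) :
  0 <= t -> 0 <= e -> (forall a, a \in s -> `|a - t| <= e) ->
  `| (\prod_(a <- s) ('X + a%:P))`_j - (('X + t%:P) ^+ size s)`_j |
   <= (('X + (t + e)%:P) ^+ size s)`_j - (('X + t%:P) ^+ size s)`_j.
Proof.
move=> t0 e0; elim: s j => [|a s IH] j Hs.
  by rewrite big_nil !expr0 !subrr normr0.
rewrite big_cons /= !exprS !mulrDl !coefD !coefXM !coefCM.
have {}IH i : `| (\prod_(a <- s) ('X + a%:P))`_i - (('X + t%:P) ^+ size s)`_i |
   <= (('X + (t + e)%:P) ^+ size s)`_i - (('X + t%:P) ^+ size s)`_i.
  by apply: IH => b bs; apply: Hs; rewrite inE bs orbT.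
have Ha : `|a - t| <= e by apply: Hs; rewrite inE eqxx.
set g := \prod_(a <- s) _ in IH *; set G := (_ + t%:P) ^+ _ in IH *.
set H := (_ ^+ _) in IH *.
have H1 : `|(if j == 0%N then 0 else g`_j.-1) - (if j == 0%N then 0 else G`_j.-1)|
   <= (if j == 0%N then 0 else H`_j.-1) - (if j == 0%N then 0 else G`_j.-1).
  by case: (j == 0%N); rewrite ?subrr ?normr0.
have G0 : 0 <= G`_j by apply: coef_XaddC_exp_ge0.
have H2 : `|a * g`_j - t * G`_j| <= (t + e) * H`_j - t * G`_j.
  have -> : a * g`_j - t * G`_j = a * (g`_j - G`_j) + (a - t) * G`_j by ring.
  apply: le_trans (ler_normD _ _) _; rewrite !normrM (ger0_norm G0).
  have -> : (t + e) * H`_j - t * G`_j = (t + e) * (H`_j - G`_j) + e * G`_j by ring.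
  apply: lerD; last by apply: ler_wpM2r.
  apply: ler_pM => //.
  rewrite -[a](subrK t) addrC; apply: le_trans (ler_normD _ _) _.
  by rewrite (ger0_norm t0) lerD2l.
have -> : forall x1 x2 y1 y2 : C, (x1 + x2) - (y1 + y2) = (x1 - y1) + (x2 - y2) by move=> *; ring.
have -> : forall x1 x2 y1 y2 : C, (x1 + x2) - (y1 + y2) = (x1 - y1) + (x2 - y2) by move=> *; ring.
apply: le_trans (ler_normD _ _) _; exact: lerD.
Qed.

(** By the binomial formula the ratio of these coefficients is t (j + 1) / (n - j), at most n t. *)
Lemma coef_XaddC_exp_le (t : C) n j : 0 <= t -> (j < n)%N ->
  (('X + t%:P) ^+ n)`_j <= n%:R * t * (('X + t%:P) ^+ n)`_j.+1.
Proof.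
move=> t0; elim: n j => [|n IHn] j // jn.
have E i : (('X + t%:P) ^+ n.+1)`_i.+1
    = (('X + t%:P) ^+ n)`_i + t * (('X + t%:P) ^+ n)`_i.+1.
  by rewrite exprS mulrDl coefD coefXM coefCM.
rewrite E mulrDr.
apply: (@le_trans _ _ (n.+1%:R * t * (('X + t%:P) ^+ n)`_j)); last first.
  by rewrite lerDl !mulr_ge0 ?ler0n ?coef_XaddC_exp_ge0.
rewrite -natr1 !mulrDl mul1r.
case: j jn => [|j] jn.
  by rewrite exprS mulrDl coefD coefXM coefCM /= add0r lerDr !mulr_ge0 ?coef_XaddC_exp_ge0.
by rewrite E lerD2r; apply: IHn.
Qed.

(** The coefficient of X^j is homogeneous of degree n - j in t, so it is multiplied by u^(n - j). *)
Lemma coef_XaddC_exp_scale (t u : C) n j : 0 <= t -> 1 <= u ->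
  (('X + (t * u)%:P) ^+ n)`_j <= u ^+ n * (('X + t%:P) ^+ n)`_j.
Proof.
move=> t0 u1; have u0 : 0 <= u by apply: le_trans u1; apply: ler01.
elim: n j => [|n IHn] j; first by rewrite !expr0 mul1r.
rewrite !exprS !mulrDl !coefD !coefXM !coefCM mulrDr; apply: lerD.
  case: j => [|j] /=; first by rewrite mulr0.
  apply: le_trans (IHn j) _; rewrite ler_wpM2r ?coef_XaddC_exp_ge0 //.
  by rewrite ler_peMl ?exprn_ge0.
have -> : u * u ^+ n * (t * (('X + t%:P) ^+ n)`_j)
  = t * u * (u ^+ n * (('X + t%:P) ^+ n)`_j) by ring.
by rewrite ler_wpM2l ?mulr_ge0.
Qed.

(** For x = 1 / (3n + 1), n x <= 1/3 and (1 + x)^n (1 - n x) <= 1, the latter by induction on the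
    exponent. *)
Lemma one_add_inv_exp_le n : (1 + (n * 3).+1%:R^-1) ^+ n <= 3 / 2 :> C.
Proof.
set x := (_^-1); have x0 : 0 <= x by rewrite invr_ge0 ler0n.
have nx : n%:R * x <= 3^-1.
  rewrite /x ler_pdivrMr ?ltr0Sn // mulrC ler_pdivlMr ?ltr0n // -natrM ler_nat.
  by rewrite leqnSn.
suff H m : (m <= n)%N -> (1 + x) ^+ m * (1 - m%:R * x) <= 1.
  have H1 := H n (leqnn n).
  have P : 0 < 1 - n%:R * x.
    rewrite subr_gt0; apply: le_lt_trans nx _.
    by rewrite invf_lt1 ?ltr1n // ltr0n.
  move: H1; rewrite -ler_pdivlMr // => /le_trans; apply.
  rewrite mul1r -[3 / 2]invrK lef_pV2 ?posrE // ?invr_gt0 ?divr_gt0 ?ltr0n //.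
  rewrite invf_div -[2 / 3](_ : 1 - 3^-1 = _); last by field.
  by rewrite lerD2l lerN2.
elim: m => [|m IH] mn; first by rewrite expr0 mul0r subr0 mulr1.
apply: le_trans (IH (ltnW mn)).
have -> : (1 + x) ^+ m.+1 * (1 - m.+1%:R * x)
   = (1 + x) ^+ m * (1 - m%:R * x) - (1 + x) ^+ m * (m.+1%:R * x * x).
  by rewrite exprS -natr1; ring.
by rewrite lerBlDr lerDl !mulr_ge0 ?exprn_ge0 ?ler0n ?addr_ge0.
Qed.

(** Write q(X + t) = (X - (V - t)) g and G = (X + t)^n. The roots in s are so small against t that
    g_i differs from G_i by at most G_i / 2. The coefficient is g_(j-1) - (V - t) g_j, where
    |g_(j-1)| <= 3/2 G_(j-1) <= 3/2 n t G_j <= (V - t) / 2 * G_j and g_j is at least half of G_j. *)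
Lemma shift_coef_le0 (q : {poly int}) (V : C) (s : seq C) (t : nat) :
  pZ q = ('X - V%:P) * prodX s -> (0 < t)%N ->
  (forall x, x \in s -> (size s * 3).+1%:R * `|x| <= t%:R) ->
  (size s * 3).+1%:R * t%:R < V ->
  forall j, (j <= size s)%N -> (q \Po ('X + t%:R%:P))`_j <= 0.
Proof.
move=> Eq t0 Hs HV j jn.
set n := size s in HV Hs jn *.
have T0 : 0 < t%:R :> C by rewrite ltr0n.
pose s' := [seq t%:R - x | x <- s].
pose g := \prod_(a <- s') ('X + a%:P).
pose G := ('X + t%:R%:P) ^+ n : {poly C}.
have Eg : pZ (q \Po ('X + t%:R%:P)) = ('X - (V - t%:R)%:P) * g.
  rewrite map_comp_poly /= Eq comp_polyM comp_polyB comp_polyX comp_polyC.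
  rewrite rmorphD /= map_polyX map_polyC /= rmorph_nat; congr (_ * _).
    by rewrite polyCB; ring.
  rewrite /g /s' big_map rmorph_prod /=; apply: eq_bigr => x _.
  by rewrite comp_polyB comp_polyX comp_polyC polyCB; ring.
pose e := t%:R / (n * 3).+1%:R : C.
have e0 : 0 <= e by rewrite divr_ge0 ?ler0n.
have Hg i : `|g`_i - G`_i| <= 2^-1 * G`_i.
  have szs' : size s' = n by rewrite size_map.
  rewrite /g /G -szs'.
  apply: le_trans (coef_prod_XaddC_le (e := e) _ (ltW T0) e0 _) _.
    move=> a /mapP [x xs ->].
    rewrite addrAC subrr add0r normrN /e ler_pdivlMr ?ltr0Sn // mulrC.
    exact: Hs.
  have -> : t%:R + e = t%:R * (1 + (n * 3).+1%:R^-1) by rewrite /e mulrDr mulr1.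
  rewrite szs' lerBlDr.
  have u1 : 1 <= 1 + (n * 3).+1%:R^-1 :> C by rewrite lerDl invr_ge0 ler0n.
  apply: le_trans (coef_XaddC_exp_scale n i (ltW T0) u1) _.
  rewrite -[X in _ <= _ + X]mul1r -mulrDl.
  apply: ler_wpM2r; first by rewrite coef_XaddC_exp_ge0 ?ltW.
  apply: le_trans (one_add_inv_exp_le n) _.
  by rewrite le_eqVlt; apply/orP; left; apply/eqP; field.
have G0 i : 0 <= G`_i by apply: coef_XaddC_exp_ge0; rewrite ltW.
have Hg2 i : `|g`_i| <= 3 / 2 * G`_i.
  rewrite -[g`_i](subrK G`_i); apply: le_trans (ler_normD _ _) _.
  rewrite (ger0_norm (G0 i)) (_ : 3 / 2 * _ = 2^-1 * G`_i + G`_i); last by field.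
  by rewrite lerD2r.
have W0 : 3 * n%:R * t%:R < V - t%:R.
  by rewrite ltrBrDr; apply: le_lt_trans HV; rewrite -[(n * 3).+1%:R]natr1 natrM le_eqVlt; apply/orP; left; apply/eqP; ring.
have Wp : 0 < V - t%:R.
  by apply: le_lt_trans W0; rewrite !mulr_ge0 ?ler0n.
set z := (_ `_ j).
rewrite -(ler_int C) /=.
have Ez : z%:~R = (if j == 0%N then 0 else g`_j.-1) - (V - t%:R) * g`_j.
  by rewrite /z -coef_map /= Eg mulrBl coefB coefXM coefCM.
set u : C := if _ then _ else _ in Ez.
have Hu : `|u| <= 2^-1 * (V - t%:R) * G`_j.
  rewrite /u; case: (j) jn => [|i] /= i_n.
    by rewrite normr0 !mulr_ge0 ?invr_ge0 ?ler0n // ltW.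
  apply: le_trans (Hg2 i) _.
  apply: (@le_trans _ _ (3 / 2 * (n%:R * t%:R * G`_i.+1))).
    by rewrite ler_wpM2l ?divr_ge0 ?ler0n // coef_XaddC_exp_le // ltW.
  have -> : 3 / 2 * (n%:R * t%:R * G`_i.+1) = 2^-1 * (3 * n%:R * t%:R) * G`_i.+1 by ring.
  by rewrite ler_wpM2r // ler_wpM2l ?invr_ge0 ?ler0n // ltW.
have Vr : V \is Num.real.
  by rewrite -[V](subrK t%:R) realD ?realn // gtr0_real.
(* The order on C is partial and g_j is controlled only through norms; w is an integer plus a real
   number, so it is at most its norm. *)
pose w : C := z%:~R + (V - t%:R) * G`_j.
have wr : w \is Num.real.
  by rewrite /w realD ?realz // ger0_real // mulr_ge0 // ltW.
suff : w <= (V - t%:R) * G`_j by rewrite /w gerDr.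
apply: le_trans (real_ler_norm wr) _.
have -> : w = u - (V - t%:R) * (g`_j - G`_j) by rewrite /w Ez; ring.
apply: le_trans (ler_normB _ _) _.
rewrite normrM (gtr0_norm Wp).
have -> : (V - t%:R) * G`_j = 2^-1 * (V - t%:R) * G`_j + (V - t%:R) * (2^-1 * G`_j) by field.
by apply: lerD => //; rewrite ler_wpM2l // ltW.
Qed.

(** * The recurrence system attached to a dominant root *)

Lemma sum_pow_bound (s : seq C) (rho D : C) (F : C -> C) n :
  0 <= rho -> 0 <= D -> (forall x, x \in s -> `|x| <= rho) -> (forall x, x \in s -> `|F x| <= D) ->
  `|\sum_(x <- s) x ^+ n * F x| <= (size s)%:R * D * rho ^+ n.
Proof.
move=> r0 D0; elim: s => [|x s IH] Hs HF; first by rewrite big_nil normr0 !mul0r.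
rewrite big_cons /= -natr1 !mulrDl mul1r addrC.
apply: le_trans (ler_normD _ _) _; apply: lerD.
  by apply: IH => y ys; [apply: Hs|apply: HF]; rewrite inE ys orbT.
rewrite normrM normrX mulrC; apply: ler_pM; rewrite ?exprn_ge0 ?HF ?inE ?eqxx //.
by rewrite lerXn2r ?nnegrE ?Hs ?inE ?eqxx.
Qed.

(** Let [a i k] be the sum of x^k (x^m - t)^i over all roots. The first recurrence comes from x^m =
    t + (x^m - t), the last from q(x^m - t) = 0, where the nonleading coefficients of q are
    nonpositive. A shift of k by n0 makes the term of v dominate, hence all values positive. *)
Lemma dominant_root_system (p : {poly int}) (s : seq C) (v rho : C) (B : nat) :
  pZ p = prodX (v :: s) -> 0 < v -> v <= B%:R ->
  (forall x, x \in s -> `|x| <= rho) -> 0 < rho -> rho <= B%:R ->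
  (forall K : nat, exists r0, forall r, (r0 <= r)%N -> exists t : nat,
      K%:R * rho ^+ r <= t%:R /\ K%:R * t%:R < v ^+ r) ->
  exists (m n t : nat) (c : nat -> nat) (A : nat -> nat -> nat),
  [/\ (0 < m)%N,
    forall i k, (i < n)%N -> A i (k + m)%N = (t * A i k + A i.+1 k)%N,
    forall k, A n (k + m)%N = (t * A n k + \sum_(i < n.+1) c i * A i k)%N,
    forall i k, (i <= n)%N -> (0 < A i k)%N &
    forall K : nat, exists n1, forall k, (n1 <= k)%N ->
      K%:R * `|(A 0 k.+1)%:R - v * (A 0 k)%:R| <= (A 0 k)%:R :> C].
Proof.
move=> Ep v0 vB Hs r0 rB Harch; pose n := size s.
have rho0 := ltW r0.

have Hdom K : exists r1, forall r, (r1 <= r)%N -> K%:R * rho ^+ r <= v ^+ r.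
  have [r1 Hr1] := Harch K.+1; exists r1 => r /Hr1 [t [H1 H2]].
  apply: le_trans (le_trans _ H1) (le_trans _ (ltW H2)).
    by rewrite ler_wpM2r ?exprn_ge0 // ler_nat.
  by rewrite ler_peMl ?ler0n ?ler1n.
(* One more than the constant 3n + 1 of [shift_coef_le0]: the surplus gives v^m - t >= 1, used for
   positivity. *)
have [r1 Hr1] := Harch (n * 3).+2.
pose m := (2 ^ r1)%N.
have [t [Ht1 Ht2]] := Hr1 m (ltnW (ltn_expl r1 (ltnSn 1))).
have t0 : (0 < t)%N.
  by rewrite -(ltr0n C); apply: lt_le_trans Ht1; rewrite mulr_gt0 ?ltr0Sn ?exprn_gt0.
have kt : (n * 3).+1%:R * t%:R < v ^+ m :> C.
  by apply: le_lt_trans Ht2; rewrite ler_wpM2r ?ler0n // ler_nat.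
have [q0 Eq0] := graeffe_iter r1 Ep.
pose q := q0 \Po ('X + t%:R%:P).
have Eq : pZ q = prodX [seq x ^+ m - t%:R | x <- v :: s].
  rewrite /q; move: (v :: s) Eq0 => l Eq0.
  rewrite map_comp_poly /= Eq0 rmorphD /= map_polyX map_polyC /= rmorph_nat.
  rewrite rmorph_prod !big_map; apply: eq_bigr => x _ /=.
  by rewrite comp_polyB comp_polyX comp_polyC polyCB; ring.
have q_le0 i : (i <= n)%N -> q`_i <= 0.
  move=> i_n; apply: (@shift_coef_le0 q0 (v ^+ m) [seq x ^+ m | x <- s]) => //.
  - by rewrite Eq0 /= big_cons.
  - move=> y /mapP [x xs ->]; rewrite size_map.
    apply: le_trans Ht1; rewrite -/n normrX; apply: ler_pM; rewrite ?ler0n ?exprn_ge0 ?ler_nat //.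
    by rewrite lerXn2r ?nnegrE ?Hs.
  - by rewrite size_map.
  - by rewrite size_map.
(* For monic q with nonpositive lower coefficients, the leading term equals q(y) plus a combination
   with coefficients |q_i|; these become the [c i]. *)
have q_root (y : C) : y ^+ n.+1 = \sum_(i < n.+1) `|(q`_i)%R|%N%:R * y ^+ i + (pZ q).[y].
  have Sq : size (pZ q) = n.+2 by rewrite Eq size_prod_XsubC /= size_map.
  have Lq : (pZ q)`_n.+1 = 1.
    have /monicP := monic_prod_XsubC [seq x ^+ m - t%:R | x <- v :: s] xpredT id.
    by rewrite -Eq /lead_coef Sq.
  rewrite horner_coef Sq [X in _ = _ + X]big_ord_recr /= Lq mul1r addrA -big_split /=.
  rewrite big1 ?add0r // => i _; rewrite -mulrDl coef_map /=.
  suff -> : `|(q`_i)%R|%N%:R = - (q`_i)%:~R :> C by rewrite addNr mul0r.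
  have := q_le0 i; rewrite -ltnS ltn_ord => /(_ isT) qi.
  by rewrite -[_%:R]/(_%:Z%:~R) abszE ler0_norm // rmorphN.
pose F i x : C := (x ^+ m - t%:R) ^+ i.
have Ha (i k : nat) : exists z : int, z%:~R == \sum_(x <- v :: s) x ^+ k * F i x.
  have [z Ez] := power_sum_int ('X^k * ('X^m - t%:R%:P) ^+ i) Ep.
  exists z; rewrite Ez; apply/eqP; apply: eq_bigr => x _.
  by rewrite rmorphM !rmorphXn rmorphB /= rmorphXn /= map_polyX map_polyC /= rmorph_nat
    hornerM !hornerXn horner_exp hornerD hornerN hornerC hornerXn.
pose a i k := xchoose (Ha i k).
have Ea i k : (a i k)%:~R = \sum_(x <- v :: s) x ^+ k * F i x by apply/eqP/(xchooseP (Ha i k)).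
have a_step i k : a i (k + m)%N = t%:R * a i k + a i.+1 k.
  apply: (@intr_inj C); rewrite rmorphD rmorphM /= !Ea rmorph_nat.
  rewrite mulr_sumr -big_split; apply: eq_bigr => x _ /=.
  by rewrite /F exprD exprS; ring.
have a_last k : a n.+1 k = \sum_(i < n.+1) `|(q`_i)%R|%N%:R * a i k.
  apply: (@intr_inj C); rewrite rmorph_sum /= Ea.
  under [RHS]eq_bigr => i _ do rewrite rmorphM /= Ea rmorph_nat mulr_sumr.
  rewrite exchange_big /= !big_seq; apply: eq_bigr => x xs.
  rewrite /F q_root (_ : _.[_] = 0) ?addr0; last first.
    apply/rootP; rewrite Eq root_prod_XsubC; apply/mapP; by exists x.
  by rewrite mulr_sumr; apply: eq_bigr => i _; ring.
pose D := ((B ^ m + t) ^ n)%N.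
have HF x i : (i <= n)%N -> x \in s -> `|F i x| <= D%:R.
  move=> i_n xs; rewrite /F normrX.
  have Hx : `|x ^+ m - t%:R| <= (B ^ m + t)%:R.
    apply: le_trans (ler_normB _ _) _; rewrite natrD normr_nat lerD2r normrX natrX.
    by rewrite lerXn2r ?nnegrE ?ler0n // (le_trans (Hs x xs)).
  apply: (@le_trans _ _ ((B ^ m + t)%:R ^+ i)); first by rewrite lerXn2r ?nnegrE ?ler0n.
  by rewrite -natrX ler_nat leq_pexp2l // addn_gt0 t0 orbT.
have g1 : 1 <= v ^+ m - t%:R.
  rewrite lerBrDr; apply: le_trans (ltW Ht2).
  by rewrite addrC -natrM natr1 ler_nat -[X in (X <= _)%N]add1n mulSn addnC leq_add2l muln_gt0.
(* From n0 on, v^k >= (n D + 1) rho^k, which beats the total n D rho^k of the other roots; the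
   factor (v^m - t)^i is at least 1. *)
have [n0 Hn0] := Hdom (n * D).+1.
have a_gt0 i k : (i <= n)%N -> 0 < a i (k + n0)%N.
  move=> i_n; rewrite -(ltr0z C) Ea big_cons.
  set S := \sum_(x <- s) _.
  have HS : `|S| <= (n * D)%:R * rho ^+ (k + n0).
    by rewrite natrM; apply: sum_pow_bound => //; rewrite ?ler0n // => x; apply: HF.
  have H1 : (n * D)%:R * rho ^+ (k + n0) < v ^+ (k + n0) * F i v.
    apply: lt_le_trans (le_trans (Hn0 _ (leq_addl k n0)) _).
      by rewrite ltr_pM2r ?exprn_gt0 // ltr_nat.
    by rewrite ler_peMr ?exprn_ge0 ?(ltW v0) // exprn_ege1.
  have Sr : S \is Num.real.
    have -> : S = (a i (k + n0)%N)%:~R - v ^+ (k + n0) * F i v by rewrite Ea big_cons addrC addKr.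
    rewrite realB ?realz // realM ?realX ?gtr0_real //.
    by apply: lt_le_trans g1; apply: ltr01.
  rewrite -ltrBlDr sub0r; apply: le_lt_trans H1; apply: le_trans HS.
  by rewrite -normrN; apply: real_ler_norm; rewrite realN.
exists m, n, t, (fun i => `|(q`_i)%R|%N), (fun i k => `|a i (k + n0)%N|%N).
have aE i k : (i <= n)%N -> (`|a i (k + n0)|%N)%:Z = a i (k + n0)%N.
  by move=> i_n; rewrite abszE gtr0_norm // a_gt0.
split=> //.
- by rewrite expn_gt0.
- move=> i k i_n; apply/eqP; rewrite -eqz_nat PoszD PoszM !aE ?(ltnW i_n) //.
  by rewrite addnAC a_step natz.
- move=> k; apply/eqP; rewrite -eqz_nat PoszD PoszM !aE // addnAC a_step a_last natz.
  apply/eqP; congr (_ + _); rewrite -natz natr_sum; apply: eq_bigr => i _.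
  by rewrite natrM; congr (_ * _); rewrite natz aE // -ltnS.
- by move=> i k i_n; rewrite absz_gt0 gt_eqF // a_gt0.
(* The error A(k+1) - v A(k) is the sum of x^N (x - v) over s, at most 2 n B rho^N, while A(k) >=
   v^N - n rho^N; the constant combines both bounds. *)
move=> K; have [n1 Hn1] := Hdom (K * (n * (B + B)) + n)%N; exists n1 => k kn1.
have nE j : (`|a 0%N (j + n0)|%N)%:R = v ^+ (j + n0) + \sum_(x <- s) x ^+ (j + n0) * 1 :> C.
  rewrite -[_%:R]/(_%:Z%:~R) aE // Ea big_cons /F expr0 mulr1; congr (_ + _).
rewrite !nE addSn.
have -> : (v ^+ (k + n0).+1 + \sum_(x <- s) x ^+ (k + n0).+1 * 1) -
    v * (v ^+ (k + n0) + \sum_(x <- s) x ^+ (k + n0) * 1)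
   = \sum_(x <- s) x ^+ (k + n0) * (x - v).
  rewrite mulrDr [v ^+ _.+1]exprS opprD addrACA subrr add0r mulr_sumr -sumrB.
  by apply: eq_bigr => x _; rewrite exprS; ring.
set N := (k + n0)%N.
have HN : (K * (n * (B + B)) + n)%:R * rho ^+ N <= v ^+ N by apply: Hn1; rewrite /N (leq_trans kn1) ?leq_addr.
have H1 : `|\sum_(x <- s) x ^+ N * (x - v)| <= n%:R * (B + B)%:R * rho ^+ N.
  apply: sum_pow_bound; rewrite ?ler0n // => x xs.
  apply: le_trans (ler_normB _ _) _; rewrite natrD; apply: lerD.
    by apply: le_trans rB; apply: Hs.
  by rewrite gtr0_norm.
have H2 : `|\sum_(x <- s) x ^+ N * 1| <= n%:R * 1 * rho ^+ N.
  by apply: sum_pow_bound => // x _; rewrite normr1.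
apply: le_trans (_ : v ^+ N - n%:R * rho ^+ N <= _); last first.
  rewrite lerD2l; rewrite mulr1 in H2.
  have Sr : \sum_(x <- s) x ^+ N * 1 \is Num.real.
    have -> : \sum_(x <- s) x ^+ N * 1 = (a 0%N (k + n0)%N)%:~R - v ^+ N.
      by rewrite -(aE 0%N k) // -[_%:~R]/(_%:R) nE addrC addKr.
    by rewrite realB ?realz ?realX ?gtr0_real.
  rewrite lerNl; apply: le_trans H2.
  by rewrite -normrN; apply: real_ler_norm; rewrite realN.
rewrite lerBrDr; apply: le_trans HN; rewrite natrD mulrDl lerD2r natrM -mulrA natrM.
by rewrite ler_wpM2l ?ler0n.
Qed.

(* By Gauss's lemma the gcd of p and p' is, up to a scalar, a monic integer polynomial. *)
Lemma min_poly_simple_root (p : {poly int}) (v : C) :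
  p \is monic -> root (pZ p) v ->
  (forall g : {poly int}, g \is monic -> root (pZ g) v -> (size p <= size g)%N) ->
  ~~ root (pZ p)^`() v.
Proof.
move=> Mp rv Hmin; apply/negP => rv'.
pose pQ := map_poly (intr : int -> rat) p.
have EpC : pZ p = map_poly (ratr : rat -> C) pQ.
  by rewrite -map_poly_comp; apply: eq_map_poly => x /=; rewrite ratr_int.
pose g := gcdp pQ pQ^`().
have rg : root (map_poly (ratr : rat -> C) g) v.
  by rewrite gcdp_map root_gcd -EpC rv /= -deriv_map -EpC.
have /dvdpP_rat_int [g1 [a a0 Eg] [r Er]] : g %| pQ by apply: dvdp_gcdl.
have /eqP := monicP Mp; rewrite Er lead_coefM => /eqP L1.
(* An integer divisor of a monic polynomial has leading coefficient 1 or -1; multiplying by it makes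
   the divisor monic. *)
have Lu : lead_coef g1 \is a GRing.unit.
  by apply/unitrP; exists (lead_coef r); rewrite mulrC L1.
have L2 : lead_coef g1 * lead_coef g1 = 1.
  by move: Lu; rewrite unfold_in /= => /orP [] /eqP ->.
pose g2 := lead_coef g1 *: g1.
have Mg2 : g2 \is monic by apply/monicP; rewrite lead_coefZ.
have rg2 : root (pZ g2) v.
  move: rg; rewrite Eg map_polyZ rootZ ?fmorph_eq0 //= => rg.
  rewrite map_polyZ rootE hornerZ.
  have -> : pZ g1 = map_poly (ratr : rat -> C) (map_poly intr g1).
    by rewrite -map_poly_comp; apply: eq_map_poly => x /=; rewrite ratr_int.
  by rewrite (eqP rg) mulr0.
have := Hmin _ Mg2 rg2; apply/negP; rewrite -ltnNge.
have Sp : size pQ = size p by rewrite size_map_inj_poly //; apply: intr_inj.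
have p1 : (1 < size p)%N.
  have : pZ p != 0 by rewrite -size_poly_eq0 size_map_inj_poly ?size_poly_eq0 ?monic_neq0 //; apply: intr_inj.
  by move/root_size_gt1 => /(_ _ rv); rewrite size_map_inj_poly //; apply: intr_inj.
have Sg : size g2 = size g.
  have l0 : lead_coef g1 != 0 by apply: contraTneq Lu => ->; rewrite unitr0.
  by rewrite Eg /g2 !size_scale // size_map_inj_poly //; apply: intr_inj.
have pQ0 : pQ != 0 by rewrite -size_poly_gt0 Sp ltnW.
have dQ0 : pQ^`() != 0.
  have : lead_coef pQ != 0 by rewrite lead_coef_eq0.
  rewrite lead_coefE Sp; case: (size p) p1 => [|[|k]] //= _.
  apply: contraNneq => /polyP/(_ k)/eqP.
  by rewrite coef_deriv coef0 mulrn_eq0.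
rewrite Sg -Sp; apply: leq_ltn_trans (lt_size_deriv pQ0).
by apply: dvdp_leq => //; apply: dvdp_gcdr.
Qed.
End DominantRoot.

(** * Transfer from integer lists, real numbers and pairs to polynomials over the complex field *)

Section Bridge.
Import ssrZ Rstruct complex.
Notation R := Rdefinitions.R.
Local Notation RC := (complex R).
Local Notation toR := (map_poly (intr : int -> R)).
Local Notation toC := (map_poly (intr : int -> RC)).

Definition poly_of_Zlist (P : seq BinNums.Z) : {poly int} := Poly (map int_of_Z P).

Definition complex_of_pair (z : R * R) : RC := Complex z.1 z.2.

Lemma IZR_int_of_Z (z : BinNums.Z) : IZR z = (int_of_Z z)%:~R.
Proof.
rewrite -[z in LHS]int_of_ZK; case: (int_of_Z z) => n /=.
  by rewrite -INR_IZR_INZ INRE.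
by rewrite opp_IZR -INR_IZR_INZ INRE NegzE rmorphN addn1.
Qed.

Lemma real_complex_int (z : int) : real_complex R z%:~R = z%:~R.
Proof. by rewrite rmorph_int. Qed.

Lemma zpoly_evalE P x : zpoly_eval P x = (toR (poly_of_Zlist P)).[x].
Proof.
rewrite /poly_of_Zlist; elim: P => [|c P IH] /=; first by rewrite map_poly0 horner0.
rewrite IH cons_poly_def rmorphD rmorphM /= map_polyX map_polyC /= hornerMXaddC.
by rewrite IZR_int_of_Z RplusE RmultE addrC mulrC.
Qed.

Lemma zpoly_cevalE P z :
  complex_of_pair (zpoly_ceval P z) = (toC (poly_of_Zlist P)).[complex_of_pair z].
Proof.
rewrite /poly_of_Zlist; elim: P => [|c P IH] /=; first by rewrite map_poly0 horner0.
rewrite cons_poly_def rmorphD rmorphM /= map_polyX map_polyC /= hornerMXaddC -IH.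
rewrite -real_complex_int -IZR_int_of_Z addrC.
apply/eqP; rewrite eq_complex /= !RplusE !RmultE !RminusE; apply/andP; split; apply/eqP.
  by rewrite [z.1 * _]mulrC [z.2 * _]mulrC.
by rewrite [X in _ + X]addrC [z.1 * _]mulrC [z.2 * _]mulrC.
Qed.

Lemma horner_toC (p : {poly int}) (x : R) : (toC p).[x%:C%C] = ((toR p).[x])%:C%C.
Proof.
rewrite -horner_map -map_poly_comp; congr (_.[_]).
by apply: eq_map_poly => z /=; rewrite real_complex_int.
Qed.

(** [Poly] drops trailing zeros, but the last entry is 1, so the length is preserved. *)
Lemma zpoly_monic_poly P : zpoly_monic P ->
  poly_of_Zlist P \is monic /\ size (poly_of_Zlist P) = length P.
Proof.
case=> l ->.
have E : poly_of_Zlist (l ++ [:: BinNums.Zpos xH]) = map int_of_Z (l ++ [:: BinNums.Zpos xH]) :> seq int.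
  by apply: (@PolyK _ 0); rewrite map_cat last_cat.
split; last by rewrite E size_map.
by rewrite monicE lead_coefE E nth_last map_cat last_cat.
Qed.

Lemma monic_zpoly (p : {poly int}) : p \is monic -> exists P,
  [/\ zpoly_monic P, poly_of_Zlist P = p & length P = size p].
Proof.
move=> Mp; exists (map Z_of_int p); split; last by rewrite -[length _]/(size _) size_map.
  have : last 0 p = 1 by rewrite -nth_last -lead_coefE (monicP Mp).
  case/lastP: (polyseq p) => [|l x] //; rewrite last_rcons => ->.
  by exists (map Z_of_int l); rewrite map_rcons -cats1.
rewrite /poly_of_Zlist -map_comp (eq_map (g := id)) ?map_id ?polyseqK //.
by move=> x /=; rewrite Z_of_intK.
Qed.

Lemma norm_complex_of_pair z : `|complex_of_pair z| = (cmod z)%:C%C.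
Proof. by rewrite normc_def /cmod RsqrtE RplusE !RpowE. Qed.

(** The Perron condition bounds the roots different from v. That v does not occur a second time
    among the roots follows from its simplicity in the minimal polynomial. *)
Lemma perron_roots v : is_perron v -> exists (p : {poly int}) (s : seq RC),
  toC p = \prod_(x <- v%:C%C :: s) ('X - x%:P) /\
  forall x, x \in s -> exists r : R, `|x| = r%:C%C /\ Rlt r v.
Proof.
case=> v0 [[P0 [MP0 rP0]] Hconj].
(* [is_perron] speaks about any minimal polynomial; one is obtained by descent on the length of an
   annihilating list. *)
have [P [MP rP Pmin]] : exists P, [/\ zpoly_monic P, zpoly_eval P v = R0 &
    forall Q, zpoly_monic Q -> zpoly_eval Q v = R0 -> (length P <= length Q)%coq_nat].
  have [n] := ubnP (length P0); elim: n => // n IH in P0 MP0 rP0 *; rewrite ltnS => Hn.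
  have [[Q [MQ rQ HQ]]|H] := boolp.pselect (exists Q, [/\ zpoly_monic Q, zpoly_eval Q v = R0 &
     (length Q < length P0)%N]).
    by apply: (IH Q MQ rQ); apply: leq_trans Hn.
  exists P0; split=> // Q MQ rQ; apply/ssrnat.leP; rewrite leqNgt; apply/negP => HQ.
  by apply: H; exists Q.
have [Mp Sp] := zpoly_monic_poly MP.
set p := poly_of_Zlist P in Mp Sp.
have root_toC (g : {poly int}) : root (toC g) v%:C%C <-> (toR g).[v] = 0.
  rewrite /root horner_toC; split=> [/eqP|->]; last by rewrite rmorph0.
  by move/complexI.
have simple : ~~ root (toC p)^`() v%:C%C.
  apply: min_poly_simple_root => //; first by apply/root_toC; rewrite -zpoly_evalE.
  move=> g Mg /root_toC rg; have [Q [MQ EQ <-]] := monic_zpoly Mg.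
  by rewrite Sp; apply/ssrnat.leP/Pmin => //; rewrite zpoly_evalE EQ.
have [r Er] := closed_field_poly_normal (toC p).
have L1 : lead_coef (toC p) = 1.
  by rewrite lead_coef_map_inj ?(monicP Mp) //; apply: intr_inj.
rewrite L1 scale1r in Er.
have vr : v%:C%C \in r.
  by rewrite -root_prod_XsubC -Er; apply/root_toC; rewrite -zpoly_evalE.
have Er' : toC p = \prod_(x <- v%:C%C :: rem v%:C%C r) ('X - x%:P).
  by rewrite Er; apply: perm_big; apply: perm_to_rem.
exists p, (rem v%:C%C r); split=> // x xr.
have xv : x != v%:C%C.
  apply: contraNneq simple => xv; rewrite xv in xr.
  rewrite Er' big_cons derivM derivXsubC mul1r rootE hornerD hornerM hornerXsubC subrr mul0r addr0.
  by rewrite -rootE root_prod_XsubC.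
pose z : R * R := (Re x, Im x).
have Ez : complex_of_pair z = x by rewrite /complex_of_pair /z; case: (x).
have xroot : root (toC p) x by rewrite Er' root_prod_XsubC inE xr orbT.
have zroot : zpoly_ceval P z = (R0, R0).
  have := zpoly_cevalE P z; rewrite Ez (eqP xroot).
  by case: (zpoly_ceval P z) => a b [-> ->].
exists (cmod z); split; first by rewrite -Ez norm_complex_of_pair.
rewrite -(Rabs_right v); last exact: Rle_ge (Rlt_le _ _ v0).
apply: (Hconj P _ z zroot) => // zv.
by move/eqP: xv; apply; rewrite -Ez zv.
Qed.

Lemma perron_system (v : R) : is_perron v -> Rlt R1 v ->
  exists (m n t : nat) (c : nat -> nat) (A : nat -> nat -> nat),
  [/\ (0 < m)%coq_nat,
    forall i k, (i < n)%coq_nat -> A i (k + m)%N = (t * A i k + A (S i) k)%N,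
    forall k, A n (k + m)%N =
      (t * A n k + list_sum (List.map (fun i => c i * A i k) (List.seq 0 (S n))))%N,
    forall i k, (i <= n)%coq_nat -> (1 <= A i k)%coq_nat &
    forall K : nat, exists n1, forall k, (n1 <= k)%coq_nat ->
      Rle (INR K * Rabs (INR (A 0 (S k)) - v * INR (A 0 k))) (INR (A 0 k))].
Proof.
move=> Pv v1; have [p [s [Ep Hs]]] := perron_roots Pv.
have v1' : 1 < v by apply/RltP.
(* The maximum of 1 and the moduli of the other roots; it stays below v because v > 1, and rho >= 1
   is what [geometric_gap] asks for. *)
have [rho [rho1 rhov Hrho]] : exists rho : R, [/\ 1 <= rho, rho < v &
    forall x, x \in s -> `|x| <= rho%:C%C].
  elim: s {Ep} Hs => [|x s IH] Hs; first by exists 1; rewrite lexx.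
  have [y ys|rho [H1 H2 H3]] := IH; first by apply: Hs; rewrite inE ys orbT.
  have [r [Er /RltP rv]] := Hs x (mem_head _ _).
  exists (Num.max rho r); split; first by rewrite le_max H1.
    by rewrite gt_max H2.
  move=> y; rewrite inE => /predU1P [->|ys]; first by rewrite Er lecR le_max lexx orbT.
  by apply: le_trans (H3 y ys) _; rewrite lecR le_max lexx.
pose B := Num.bound v.
have v0 : 0 < v by apply: lt_trans v1'.
have vB : v <= B%:R by apply/ltW/archi_boundP/ltW.
have rho0 : 0 < rho by apply: lt_le_trans rho1.
have natC k : (k%:R)%:C%C = k%:R :> RC by rewrite rmorph_nat.
have [||||||m [n [t [c [A [m0 A1 A2 A3 A4]]]]]] :=
  @dominant_root_system _ p s v%:C%C rho%:C%C B Ep; rewrite ?ltcR -?natC ?lecR //.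
- by rewrite (le_trans (ltW rhov)).
- move=> K; have [|r0 Hr0] := @geometric_gap v rho _ K; first by split; [apply/RleP|apply/RltP].
  exists r0 => r /ssrnat.leP /Hr0 [u [/RleP H1 /RltP H2]]; exists u.
  rewrite -!natC -!rmorphXn -!rmorphM /= lecR ltcR.
  by move: H1 H2; rewrite !RmultE !RpowE !INRE natrM.
exists m, n, t, c, A; split.
- exact/ssrnat.ltP.
- by move=> i k /ssrnat.ltP; apply: A1.
- move=> k; rewrite A2; congr (_ + _)%N.
  have sumE l : forall j, (\sum_(i <- iota j l) c i * A i k)%N =
      list_sum (List.map (fun i => c i * A i k)%N (List.seq j l)).
    by elim: l => [|l IH] j /=; rewrite ?big_nil // big_cons IH.
  by rewrite -sumE -(big_mkord xpredT (fun i => c i * A i k)%N) /index_iota subn0.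
- by move=> i k /ssrnat.leP ik; apply/ssrnat.leP/A3.
move=> K; have [n1 Hn1] := A4 K; exists n1 => k /ssrnat.leP /Hn1.
rewrite -!natC -(rmorphM (real_complex R) v) -(rmorphB (real_complex R)).
rewrite normc_def /= expr0n addr0 sqrtr_sqr -(rmorphM (real_complex R)) lecR => H.
by apply/RleP; rewrite RmultE RabsE RminusE RmultE !INRE.
Qed.
End Bridge.
End Algebra.

Theorem theorem2 :
  (forall (v : R) (b : nat), is_rational v -> 1 <= v -> (2 <= b)%nat ->
     exists (xi : R) (d : nat -> nat),
       is_base_expansion b xi d /\ is_automatic b d /\ vb_eq b xi (v - 1)) /\
  (forall (v : R) (b : nat), is_perron v -> 1 < v -> (2 <= b)%nat ->
     exists (xi : R) (d : nat -> nat),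
       is_base_expansion b xi d /\ is_morphic b d /\ vb_eq b xi (v - 1)).
Proof.
  split; [exact rational_case|].
  intros v b Hp Hv Hb.
  destruct (Algebra.perron_system Hp Hv) as [m [n [t [c [A [Hm HA HAn Hpos Hlim]]]]]].
  exact (morphic_of_system v b m n t c A Hv Hb Hm HA HAn Hpos Hlim).
Qed.
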